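(* Let $(G,\mu)$ be a multiplicative group and let $A,B$ be multiplicative sets with $\mathrm E(A,B)\ge\mu(A)^{3/2}\mu(B)^{3/2}/K$ for some $K>0$. Then there exist multiplicative sets $A'''\subseteq A$ and $B'''\subseteq B$ with $\mu(A''')\ge\frac{\mu(A)}{8\sqrt2K}$, $\mu(B''')\ge\frac{\mu(B)}{8K}$, and $\mu(A'''\cdot B''')\le CK^7\mu(A)^{1/2}\mu(B)^{1/2}$, where $C$ is an absolute constant.
   Context: A multiplicative group is a topological group $G$ equipped with a non-negative Radon measure $\mu$ invariant under left translation, right translation and inversion, such that every non-empty open set has positive measure. A multiplicative set is a non-empty open precompact subset of $G$. Convolution: $f*g(x)=\int_G f(y)g(y^{-1}x)\,d\mu(y)$; $1_A$ is the indicator of $A$. The multiplicative energy is $\mathrm E(A,B)=\int_G(1_A*1_B(x))^2\,d\mu(x)$. $A\cdot B=\{ab:a\in A,b\in B\}$. *)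

(* Defs.v *)
From HB Require Import structures.
From mathcomp Require Import all_boot all_order all_algebra.
From mathcomp Require Import all_classical all_reals all_analysis.

Set Implicit Arguments.
Unset Strict Implicit.
Unset Printing Implicit Defensive.

Import Order.TTheory GRing.Theory Num.Theory.
Import numFieldNormedType.Exports.

Local Open Scope classical_set_scope.
Local Open Scope ring_scope.

(* No separation axiom: a topological group is not assumed Hausdorff. The type
   is pointed only because measurable types are; the point plays no role. *)
HB.mixin Record isTopologicalGroup G & Group G & Topological G := {
  mulg_continuous : continuous (fun p : G * G => (p.1 * p.2)%g) ;
  invg_continuous : continuous (fun x : G => (x^-1)%g)
}.

#[short(type="topologicalGroupType")]
HB.structure Definition TopologicalGroup :=
  {G of Group G & PointedTopological G & isTopologicalGroup G}.

Notation borelType G := (g_sigma_algebraType (@open G)).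

Section defs.
Context {R : realType} {G : topologicalGroupType}.
Implicit Types (mu : {measure set (borelType G) -> \bar R}) (A B : set G).
Local Open Scope ereal_scope.

(* Compact sets are Borel in Hausdorff spaces; since compact sets need not be
   closed here, the conditions only involve the compact sets that are Borel. *)
Record radon mu : Prop := Radon {
  radon_compact : forall K : set G, compact K -> <<s @open G >> K ->
    mu K < +oo ;
  radon_outer : forall E : set G, <<s @open G >> E ->
    mu E = ereal_inf [set mu U | U in [set U : set G | open U /\ E `<=` U]] ;
  radon_inner : forall U : set G, open U ->
    mu U = ereal_sup
      [set mu K | K in [set K : set G |
                        [/\ compact K, <<s @open G >> K & K `<=` U]]]
}.

Record multiplicative_group mu : Prop := MultiplicativeGroup {
  mulgroup_radon : radon mu ;
  mulgroup_left : forall (x : G) (E : set G), <<s @open G >> E ->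
    mu [set (x * y)%g | y in E] = mu E ;
  mulgroup_right : forall (x : G) (E : set G), <<s @open G >> E ->
    mu [set (y * x)%g | y in E] = mu E ;
  mulgroup_inv : forall E : set G, <<s @open G >> E ->
    mu [set (y^-1)%g | y in E] = mu E ;
  mulgroup_pos : forall U : set G, open U -> U !=set0 -> 0 < mu U
}.

Definition multiplicative_set A := [/\ A !=set0, open A & precompact A].

Definition convolution mu (f g : G -> R) (x : G) : \bar R :=
  \int[mu]_y (f (y : G) * g ((y : G)^-1 * x)%g)%:E.

Definition mul_energy mu A B : \bar R :=
  \int[mu]_x (convolution mu \1_A \1_B x) ^+ 2.

Definition product_set A B : set G := [set (a * b)%g | a in A & b in B].

End defs.

(* Main.v *)
(** Let [r = 1_A * 1_B], [s = sqrt (mu A mu B)] and [P = {r > s / 2K}]. The energy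
    bound gives [int_P r >= s^2 / 2K], so the bipartite graph on [A x B] whose edges
    are the pairs with [ab \in P] has density [d >= 1 / 2K], and [mu P <= 2Kds].
    Dependent random choice (a random neighbourhood of a point of [B]) yields
    [A'], [B'] such that each pair in [A' x B'] is joined by [>> d^5 s^2] paths of
    length three. A path [a, y, a', b] writes [c = ab] as [x (a'y)^-1 z] with
    [x = ay], [a'y] and [z = a'b] in [P]; integrating the number of such
    representations over [c \in A'B'] gives [d^5 s^2 mu(A'B') << mu(P)^3].

    No countability is assumed on [G], so open subsets of [G x G] need not be
    measurable for the product of the Borel sigma-algebras and the usual Fubini
    theorem does not apply. It is replaced by an exchange of integrals for lower
    semicontinuous functions, which rests on the inner regularity of [mu] on open
    sets; this is why every set and function below is open or semicontinuous. *)

Require Import Defs.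
From HB Require Import structures.
From mathcomp Require Import all_boot all_order all_algebra.
From mathcomp Require Import all_classical all_reals all_analysis.
From mathcomp Require Import ring lra measurable_realfun.

Set Implicit Arguments.
Unset Strict Implicit.
Unset Printing Implicit Defensive.

Import Order.TTheory GRing.Theory Num.Theory.
Import numFieldNormedType.Exports.

Local Open Scope classical_set_scope.
Local Open Scope ring_scope.

(** * Layer-cake approximation of a real number *)

Section layers.
Context {R : realType}.

(** The number of [k] with [h k < r] is the ceiling of [r / h], and [r <= h N] ensures that stopping
    at [N] cuts nothing off. *)
Lemma layer_bounds (h r : R) (N : nat) : 0 < h -> 0 <= r -> r <= h * N%:R ->
  r <= h * (\sum_(k < N) (h * k%:R < r)%R%:R) <= r + h.
Proof.
move=> h0 r0 rN.
have [rN'|rN'] := leP r (h * N%:R); last by move: rN rN'; lra.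
have H : forall n, h * (\sum_(k < n) (h * k%:R < r)%R%:R) <= r + h.
  (* Invariant: while [h n < r], the [n] layers add up to at most [h n]; afterwards the sum stays
     below [r + h]. *)
  move=> n; suff: h * (\sum_(k < n) (h * k%:R < r)%R%:R) <=
      (if (h * n%:R < r)%R then h * n%:R else r + h) by case: ifP => // + ? => /ltW; lra.
  elim: n => [|n IH]; first by rewrite big_ord0 !mulr0; case: ifP => // _; lra.
  rewrite big_ord_recr /= mulrDr; move: IH; rewrite -natr1 mulrDr mulr1.
  by case: (ltP (h * n%:R) r) => /= h1; case: (ltP (_ + h) r) => /= h2 h3; lra.
rewrite H andbT.
suff: Num.min r (h * N%:R) <= h * (\sum_(k < N) (h * k%:R < r)%R%:R) by rewrite (min_idPl rN).
elim: N {rN rN'} => [|N IH]; first by rewrite big_ord0 !mulr0 ge_min lexx orbT.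
rewrite big_ord_recr /= mulrDr; move: IH; rewrite -natr1 mulrDr mulr1 !minEle.
by case: (leP r (h * N%:R)) => h1; case: (leP r (h * N%:R + h)) => h2 /= h3; lra.
Qed.

End layers.

(** * Lower semicontinuous functions and integrals of bounded Borel functions *)

Section tau.
Context {R : realType}.

Definition lsc (X : topologicalType) (f : X -> R) :=
  forall a : R, open [set x | a < f x].

(** This class is stable under sections and under integrating out a variable ([int_section_blsc]),
    so iterated integrals never leave it. *)
Definition blsc (X : topologicalType) (f : X -> R) :=
  [/\ lsc f, forall x, 0 <= f x & exists M, forall x, f x <= M].

(** Such functions are integrable for every finite measure, which makes [bmeas] the only side
    condition for linearity and monotonicity of real-valued integrals. *)
Definition bmeas (X : ptopologicalType) (f : X -> R) :=
  measurable_fun setT (f : borelType X -> R) /\ exists M, forall x, `|f x| <= M.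

Lemma open_measurable_borel (X : ptopologicalType) (U : set X) :
  open U -> measurable (U : set (borelType X)).
Proof. by move=> oU; apply: sub_sigma_algebra. Qed.

Lemma lsc_measurable (X : ptopologicalType) (f : X -> R) :
  lsc f -> measurable_fun setT (f : borelType X -> R).
Proof.
move=> lf; apply: (measurability _ (RGenOInfty.measurableE R)).
move=> /= _ [_ [a ->]] <-; rewrite setTI.
rewrite [X in measurable X](_ : _ = [set x | a < f x]); first exact: (open_measurable_borel (lf a)).
by apply/seteqP; split=> x /=; rewrite in_itv/= andbT.
Qed.

Lemma blsc_bmeas (X : ptopologicalType) (f : X -> R) : blsc f -> bmeas f.
Proof.
move=> [lf f0 [M fM]]; split; first exact: lsc_measurable.
by exists M => x; rewrite ger0_norm.
Qed.

Lemma bmeasD (X : ptopologicalType) (f g : X -> R) :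
  bmeas f -> bmeas g -> bmeas (fun x => f x + g x).
Proof.
move=> [mf [M fM]] [mg [N gN]]; split; first exact: measurable_funD.
by exists (M + N) => x; rewrite (le_trans (ler_normD _ _))// lerD.
Qed.

Lemma bmeasZ (X : ptopologicalType) (c : R) (f : X -> R) :
  bmeas f -> bmeas (fun x => c * f x).
Proof.
move=> [mf [M fM]]; split; first exact: measurable_funM.
by exists (`|c| * M) => x; rewrite normrM ler_wpM2l.
Qed.

Lemma bmeasM (X : ptopologicalType) (f g : X -> R) :
  bmeas f -> bmeas g -> bmeas (fun x => f x * g x).
Proof.
move=> [mf [M fM]] [mg [N gN]]; split; first exact: measurable_funM.
by exists (M * N) => x; rewrite normrM ler_pM.
Qed.

Lemma bmeasB (X : ptopologicalType) (f g : X -> R) :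
  bmeas f -> bmeas g -> bmeas (fun x => f x - g x).
Proof.
move=> [mf [M fM]] [mg [N gN]]; split; first exact: measurable_funB.
by exists (M + N) => x; rewrite (le_trans (ler_normB _ _))// lerD.
Qed.

Lemma bmeas_cst (X : ptopologicalType) (c : R) : bmeas (fun _ : X => c).
Proof. by split; [exact: measurable_cst|exists `|c|]. Qed.

Lemma lscD (X : topologicalType) (f g : X -> R) :
  lsc f -> lsc g -> lsc (fun x => f x + g x).
Proof.
move=> lf lg a.
rewrite (_ : [set _ | _] = \bigcup_(b in [set: R]) ([set x | b < f x] `&` [set x | a - b < g x])).
  by apply: bigcup_open => b _; exact: openI.
apply/seteqP; split=> x /=.
  (* The splitting value is the midpoint of [a - g x] and [f x]. *)
  by move=> afg; exists ((f x + (a - g x)) / 2) => //=; split=> /=; lra.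
by move=> [b _ [/= ? ?]]; lra.
Qed.

Lemma lscZ (X : topologicalType) (c : R) (f : X -> R) :
  0 < c -> lsc f -> lsc (fun x => c * f x).
Proof.
move=> c0 lf a; rewrite (_ : [set _ | _] = [set x | a / c < f x])//.
by apply/seteqP; split=> x /=; rewrite ltr_pdivrMr// mulrC.
Qed.

Lemma lsc_cst (X : topologicalType) (c : R) : lsc (fun _ : X => c).
Proof.
move=> a; have [ac|ac] := boolP (a < c).
  by rewrite (_ : [set _ | _] = setT); [exact: openT|exact/seteqP].
rewrite (_ : [set _ | _] = set0); [exact: open0|apply/seteqP; split=> // x /= h].
Qed.

Lemma lsc_sum (X : topologicalType) (N : nat) (f : nat -> X -> R) :
  (forall i, lsc (f i)) -> lsc (fun x => \sum_(i < N) f i x).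
Proof.
move=> lf; elim: N => [|N IH].
  under eq_fun do rewrite big_ord0; exact: lsc_cst.
under eq_fun do rewrite big_ord_recr /=; exact: lscD.
Qed.

(** An approximant within half of the gap [f x - a] still exceeds [a] at [x], hence near [x], and it
    lies below [f]. *)
Lemma lsc_uniform (X : topologicalType) (f : X -> R) :
  (forall e, 0 < e -> exists2 g, lsc g & forall x, g x <= f x <= g x + e) -> lsc f.
Proof.
move=> H a; rewrite openE => x /= ax; rewrite /interior.
have [|g lg gf] := H ((f x - a) / 2); first by lra.
have : nbhs x [set y | a < g y].
  by apply: open_nbhs_nbhs; split; [exact: lg|have /= := gf x; lra].
by apply: filterS => y /= ag; have := gf y; lra.
Qed.

Lemma lsc_comp (X Y : topologicalType) (g : X -> Y) (f : Y -> R) :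
  continuous g -> lsc f -> lsc (f \o g).
Proof. by move=> cg lf a; apply: (open_comp _ (lf a)) => x _; exact: cg. Qed.

Lemma blsc_comp (X Y : topologicalType) (g : X -> Y) (f : Y -> R) :
  continuous g -> blsc f -> blsc (f \o g).
Proof.
by move=> cg [lf f0 [M fM]]; split; [exact: lsc_comp|move=> x; exact: f0|exists M => x; exact: fM].
Qed.

Section integral.
Context {X : ptopologicalType} (m : {finite_measure set (borelType X) -> \bar R}).
Implicit Types (f g : X -> R).

Definition vol (U : set X) : R := fine (m U).

Lemma volE (U : set X) : measurable (U : set (borelType X)) -> (vol U)%:E = m U.
Proof. by move=> mU; rewrite /vol fineK// fin_num_measure. Qed.

Lemma vol_ge0 (U : set X) : 0 <= vol U.
Proof. exact/fine_ge0/measure_ge0. Qed.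

Lemma bmeas_integrable f : bmeas f -> m.-integrable setT (EFin \o f).
Proof.
move=> [mf [M fM]]; apply: measurable_bounded_integrable => //.
  by rewrite ltey_eq fin_num_measure.
exists M; split; first exact: num_real.
by move=> y My x _; exact: le_trans (fM x) (ltW My).
Qed.

Lemma intD f g : bmeas f -> bmeas g ->
  \int[m]_x (f x + g x) = \int[m]_x f x + \int[m]_x g x.
Proof. by move=> bf bg; rewrite RintegralD//; exact: bmeas_integrable. Qed.

Lemma intB f g : bmeas f -> bmeas g ->
  \int[m]_x (f x - g x) = \int[m]_x f x - \int[m]_x g x.
Proof. by move=> bf bg; rewrite RintegralB//; exact: bmeas_integrable. Qed.

Lemma intZ (c : R) f : bmeas f -> \int[m]_x (c * f x) = c * \int[m]_x f x.
Proof. by move=> bf; rewrite RintegralZl//; exact: bmeas_integrable. Qed.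

Lemma int_cst (c : R) : \int[m]__ c = c * vol setT.
Proof. exact: Rintegral_cst. Qed.

Lemma le_int f g : bmeas f -> bmeas g -> (forall x, f x <= g x) ->
  \int[m]_x f x <= \int[m]_x g x.
Proof. by move=> bf bg fg; apply: le_Rintegral => //; exact: bmeas_integrable. Qed.

Lemma int_indic (U : set X) : measurable (U : set (borelType X)) ->
  \int[m]_x \1_U x = vol U.
Proof. by move=> mU; rewrite /Rintegral integral_indic// setIT. Qed.

Lemma le_vol (U V : set X) : measurable (U : set (borelType X)) ->
  measurable (V : set (borelType X)) -> U `<=` V -> vol U <= vol V.
Proof. by move=> mU mV UV; rewrite -lee_fin !volE// le_measure// inE. Qed.

Lemma bmeas_indic (U : set X) : measurable (U : set (borelType X)) -> bmeas \1_U.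
Proof.
move=> mU; split; first exact: measurable_indic.
by exists 1 => x; rewrite indicE; case: (_ \in _); rewrite ?normr1 ?normr0.
Qed.

End integral.

End tau.

(** * Tau-additive measures and the exchange of integrals for open sets *)

Section tonelli.
Context {R : realType}.

(** Continuity along upward directed families of open sets of any cardinality: the volume of the
    union is the supremum of the volumes. The argument of type [I] makes the family nonempty. *)
Definition tau_additive (X : ptopologicalType)
    (m : {finite_measure set (borelType X) -> \bar R}) :=
  forall (I : Type) (F : I -> set X), I -> (forall i, open (F i)) ->
    (forall i j, exists k, F i `|` F j `<=` F k) ->
    forall a, a < vol m (\bigcup_i F i) -> exists i, a < vol m (F i).

Lemma blsc_le_nat (X : topologicalType) (f : X -> R) (h : R) : 0 < h -> blsc f ->
  exists N, forall x, f x <= h * N%:R.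
Proof.
move=> h0 [_ f0 [M fM]]; exists (Num.bound (`|M| / h)) => x.
have : `|M| / h < (Num.bound (`|M| / h))%:R by rewrite archi_boundP// divr_ge0// ltW.
rewrite ltr_pdivrMr// mulrC => /ltW; apply: le_trans.
exact: le_trans (fM x) (ler_norm M).
Qed.

(** Integrating [layer_bounds] pointwise turns an integral, up to [h] times the total mass, into a
    finite sum of volumes of open sets, to which tau-additivity applies. *)
Lemma layers_int (X : ptopologicalType)
    (m : {finite_measure set (borelType X) -> \bar R}) (f : X -> R) (h : R) (N : nat) :
  0 < h -> blsc f -> (forall x, f x <= h * N%:R) ->
  \int[m]_x f x <= h * (\sum_(k < N) vol m [set x | h * k%:R < f x])
    <= \int[m]_x f x + h * vol m setT.
Proof.
move=> h0 bf fN.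
have bi (k : nat) : bmeas (\1_[set x | h * k%:R < f x] : X -> R).
  by apply: bmeas_indic; apply: open_measurable_borel; case: bf => lf _ _; exact: lf.
pose s n x := \sum_(k < n) (\1_[set x | h * k%:R < f x] x : R).
have bs n : bmeas (s n).
  elim: n => [|n IH].
    by under [s 0]eq_fun do rewrite /s big_ord0; exact: bmeas_cst.
  by under [s _]eq_fun do rewrite /s big_ord_recr /=; exact: bmeasD.
have -> : h * (\sum_(k < N) vol m [set x | h * k%:R < f x]) = \int[m]_x (h * s N x).
  rewrite intZ//; congr (_ * _); elim: {fN} N => [|n IH].
    rewrite big_ord0; under eq_Rintegral do rewrite /s big_ord0.
    by rewrite int_cst mul0r.
  rewrite big_ord_recr /= IH; under [RHS]eq_Rintegral do rewrite /s big_ord_recr /=.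
  rewrite (intD m (bs n) (bi n)); congr (_ + _); rewrite int_indic//.
  by apply: open_measurable_borel; case: bf => lf _ _; exact: lf.
have fb := blsc_bmeas bf.
rewrite -int_cst -intD//; last exact: bmeas_cst.
have H x : f x <= h * s N x <= f x + h.
  have [_ f0 _] := bf.
  have := layer_bounds h0 (f0 x) (fN x).
  suff -> : \sum_(k < N) (h * k%:R < f x)%R%:R = s N x by [].
  apply: eq_bigr => k _; rewrite indicE; congr ((nat_of_bool _)%:R).
  by apply/idP/idP => [?|/set_mem//]; rewrite mem_set.
apply/andP; split; apply: le_int => //.
- exact: bmeasZ.
- by move=> x; have /andP[] := H x.
- exact: bmeasZ.
- by apply: bmeasD => //; exact: bmeas_cst.
- by move=> x; have /andP[] := H x.
Qed.

(** Monotone convergence for directed families. Tau-additivity supplies an index for each of the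
    finitely many layers of [phi], and directedness gives one index that serves them all. *)
Lemma directed_int (X : ptopologicalType)
    (m : {finite_measure set (borelType X) -> \bar R}) (I : Type)
    (phi : X -> R) (Phi : I -> X -> R) : tau_additive m -> I ->
  blsc phi -> (forall i, blsc (Phi i)) ->
  (forall i j, exists k, forall x, Phi i x <= Phi k x /\ Phi j x <= Phi k x) ->
  (forall i x, Phi i x <= phi x) ->
  (forall x a, a < phi x -> exists i, a < Phi i x) ->
  forall e, 0 < e -> exists i, \int[m]_x phi x <= \int[m]_x Phi i x + e.
Proof.
move=> tm i0 bphi bPhi dir le_phi sup_phi e e0.
set V := vol m setT; have V0 : 0 <= V := vol_ge0 _ _.
(* Half of [e] pays for the layer error [h * V], the other half for a loss of [d] in each of the [N]
   layers. The added 1 in [V + 1] and [N.+1] keeps the denominators positive. *)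
pose h := e / (2 * (V + 1)); have h0 : 0 < h by rewrite divr_gt0// mulr_gt0//; lra.
have hV : h * V <= e / 2.
  by rewrite /h mulrAC ler_pdivrMr ?mulr_gt0//; lra.
have [N phiN] := blsc_le_nat h0 bphi.
pose d := e / (2 * h * N.+1%:R).
have d0 : 0 < d by rewrite divr_gt0// mulr_gt0// mulr_gt0.
have hNd : h * (N%:R * d) <= e / 2.
  rewrite (_ : e / 2 = h * (N.+1%:R * d)); last first.
    by rewrite /d; field; rewrite nat1r pnatr_eq0 /= gt_eqF.
  by rewrite ler_wpM2l ?ltW// ltr_pM2r// ltr_nat.
clearbody d.
have [i Hi] : exists i, forall k, (k < N)%N ->
    vol m [set x | h * k%:R < phi x] - d < vol m [set x | h * k%:R < Phi i x].
  elim: N d d0 {phiN hNd} => // [|n IH] d d0; first by exists i0.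
  have [i Hi] := IH d d0.
  have [j Hj] : exists j, vol m [set x | h * n%:R < phi x] - d <
      vol m [set x | h * n%:R < Phi j x].
    apply: (tm _ (fun j => [set x | h * n%:R < Phi j x])) => //.
    - by move=> j; case: (bPhi j) => l _ _; exact: (l _).
    - move=> j k; have [l Hl] := dir j k; exists l => x /=.
      by have [] := Hl x; move=> ? ? []; lra.
    - rewrite (_ : \bigcup_i _ = [set x | h * n%:R < phi x]).
        by move: d0; set v := vol _ _; lra.
      apply/seteqP; split => x /=.
        by move=> [j _ /= ?]; have := le_phi j x; lra.
      by move=> /sup_phi[j ?]; exists j.
  have [l Hl] := dir i j; exists l => k; rewrite ltnS leq_eqVlt => /predU1P[->|kn].
    apply: lt_le_trans Hj _; apply: le_vol.
    + by apply: open_measurable_borel; case: (bPhi j) => o _ _; exact: (o _).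
    + by apply: open_measurable_borel; case: (bPhi l) => o _ _; exact: (o _).
    + by move=> x /=; have [] := Hl x; lra.
  apply: lt_le_trans (Hi k kn) _; apply: le_vol.
  + by apply: open_measurable_borel; case: (bPhi i) => o _ _; exact: (o _).
  + by apply: open_measurable_borel; case: (bPhi l) => o _ _; exact: (o _).
  + by move=> x /=; have [] := Hl x; lra.
exists i.
have /andP[H1 _] := layers_int m h0 bphi phiN.
have /andP[_ H2] : \int[m]_x Phi i x <= h * (\sum_(k < N) vol m [set x | h * k%:R < Phi i x])
    <= \int[m]_x Phi i x + h * vol m setT.
  by apply: layers_int => // x; exact: le_trans (le_phi i x) (phiN x).
have H3 : \sum_(k < N) vol m [set x | h * k%:R < phi x] <=
    \sum_(k < N) vol m [set x | h * k%:R < Phi i x] + N%:R * d.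
  rewrite (_ : N%:R * d = \sum_(k < N) d); last first.
    by rewrite sumr_const card_ord mulr_natl.
  by rewrite -big_split /=; apply: ler_sum => k _; have := Hi k (ltn_ord k); lra.
have : h * (\sum_(k < N) vol m [set x | h * k%:R < phi x]) <=
    h * (\sum_(k < N) vol m [set x | h * k%:R < Phi i x] + N%:R * d).
  by rewrite ler_wpM2l// ltW.
by rewrite mulrDr -/V in H2 *; lra.
Qed.

Lemma continuous_pair (X Y Z : topologicalType) (f : X -> Y) (g : X -> Z) :
  continuous f -> continuous g -> continuous (fun x => (f x, g x)).
Proof. by move=> cf cg x; apply: cvg_pair; [exact: cf|exact: cg]. Qed.

Lemma continuous_fst (X Y : topologicalType) : continuous (@fst X Y).
Proof. by move=> x; exact: cvg_fst. Qed.

Lemma continuous_snd (X Y : topologicalType) : continuous (@snd X Y).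
Proof. by move=> x; exact: cvg_snd. Qed.

Lemma continuous_swap (X Y : topologicalType) :
  continuous (fun z : X * Y => (z.2, z.1)).
Proof. by apply: continuous_pair; [exact: continuous_snd|exact: continuous_fst]. Qed.

Lemma open_rectangle (X Y : topologicalType) (U : set X) (V : set Y) :
  open U -> open V -> open (U `*` V).
Proof.
move=> oU oV; apply: openI.
  by apply: (open_comp _ oU) => z _; exact: continuous_fst.
by apply: (open_comp _ oV) => z _; exact: continuous_snd.
Qed.

Lemma open_section1 (X Y : topologicalType) (W : set (X * Y)) (x : X) :
  open W -> open [set y | W (x, y)].
Proof.
move=> oW; rewrite openE => y /= Wxy.
have : nbhs (x, y) W by exact: open_nbhs_nbhs.
by move=> [[U V] /= [Ux Vy]] UVW; apply: filterS Vy => z Vz; apply: UVW; split=> //=; exact: nbhs_singleton.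
Qed.

Lemma open_section2 (X Y : topologicalType) (W : set (X * Y)) (y : Y) :
  open W -> open [set x | W (x, y)].
Proof.
move=> oW; apply: (@open_section1 _ _ [set z | W (z.2, z.1)] y).
by apply: (open_comp _ oW) => z _; exact: continuous_swap.
Qed.

Lemma blsc_section1 (X Y : topologicalType) (f : X * Y -> R) (x : X) :
  blsc f -> blsc (fun y => f (x, y)).
Proof.
move=> [lf f0 [M fM]]; split=> //; last by exists M.
by move=> a; exact: (@open_section1 _ _ [set z | a < f z] x (lf a)).
Qed.

Lemma blsc_section2 (X Y : topologicalType) (f : X * Y -> R) (y : Y) :
  blsc f -> blsc (fun x => f (x, y)).
Proof.
move=> bf; apply: (@blsc_comp _ _ _ (fun x => (x, y)) f _ bf).
by apply: continuous_pair => z; [exact: cvg_id|exact: cvg_cst].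
Qed.

(** The open [V] with [U * V] inside [W] for some neighbourhood [U] of [x0] are directed and exhaust
    the section at [x0]. One of them has volume above [a], and it lies in the section at every point
    of its [U]. *)
Lemma vol_section_lsc (X : topologicalType) (Y : ptopologicalType)
    (m : {finite_measure set (borelType Y) -> \bar R}) (W : set (X * Y)) :
  tau_additive m -> open W -> lsc (fun x => vol m [set y | W (x, y)]).
Proof.
move=> tm oW a; rewrite openE => x0 /= ax0; rewrite /interior.
pose P := [set V : set Y | open V /\ exists2 U, nbhs x0 U & U `*` V `<=` W].
pose I := {V : set Y | P V}.
have I0 : I.
  by exists set0; split; [exact: open0|exists setT; [exact: filterT|move=> z []]].
have [||| [V [oV [U Ux0 UVW]]] /= aV] := tm I (fun V => sval V) I0 _ _ a.
- by move=> [V []].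
- move=> [V1 [oV1 [U1 n1 UV1]]] [V2 [oV2 [U2 n2 UV2]]].
  suff h : open (V1 `|` V2) /\ exists2 U, nbhs x0 U & U `*` (V1 `|` V2) `<=` W.
    by exists (exist P _ h).
  split; first exact: openU.
  exists (U1 `&` U2); first exact: filterI.
  by move=> [x y] /= [[? ?] [?|?]]; [exact: UV1|exact: UV2].
- rewrite (_ : \bigcup_i _ = [set y | W (x0, y)])//; apply/seteqP; split=> y.
    by move=> [[V [oV [U Ux0 UVW]]] _ /= Vy]; apply: UVW; split=> //=; exact: nbhs_singleton.
  move=> /= Wxy; have : nbhs (x0, y) W by exact: open_nbhs_nbhs.
  move=> [[U V] /= [Ux Vy]] UVW.
  suff h : open V° /\ exists2 U, nbhs x0 U & U `*` V° `<=` W.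
    by exists (exist P _ h).
  split; first exact: open_interior.
  by exists U => // -[x z] /= [Ux' Vz]; apply: UVW; split=> //=; exact: interior_subset.
apply: filterS Ux0 => x Ux /=; apply: lt_le_trans aV _; apply: le_vol.
- exact: open_measurable_borel.
- apply: open_measurable_borel; exact: open_section1.
- by move=> y Vy /=; apply: UVW; split.
Qed.

Lemma vol_section1_blsc (X : topologicalType) (Y : ptopologicalType)
    (m : {finite_measure set (borelType Y) -> \bar R}) (W : set (X * Y)) :
  tau_additive m -> open W -> blsc (fun x => vol m [set y | W (x, y)]).
Proof.
move=> tm oW; split; first exact: vol_section_lsc.
  by move=> x; exact: vol_ge0.
exists (vol m setT) => x; apply: le_vol => //.
by apply: open_measurable_borel; exact: open_section1.
Qed.

Lemma vol_section2_blsc (X : ptopologicalType) (Y : topologicalType)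
    (m : {finite_measure set (borelType X) -> \bar R}) (W : set (X * Y)) :
  tau_additive m -> open W -> blsc (fun y => vol m [set x | W (x, y)]).
Proof.
move=> tm oW; apply: (@vol_section1_blsc _ _ m [set z | W (z.2, z.1)]) => //.
by apply: (open_comp _ oW) => z _; exact: continuous_swap.
Qed.

(** Layer sums are lower semicontinuous by [vol_section_lsc]. Lowered by [h * V] they lie below the
    integral and within [e] of it, so [lsc_uniform] applies. *)
Lemma int_section_blsc (X : topologicalType) (Y : ptopologicalType)
    (m : {finite_measure set (borelType Y) -> \bar R}) (f : X * Y -> R) :
  tau_additive m -> blsc f -> blsc (fun x => \int[m]_y f (x, y)).
Proof.
move=> tm bf; have [lf f0 [M fM]] := bf; split.
- apply: lsc_uniform => e e0.
  set V := vol m setT; have V0 : 0 <= V := vol_ge0 _ _.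
  pose h := e / (V + 1); have h0 : 0 < h by rewrite divr_gt0//; lra.
  have hV : h * V <= e.
    by rewrite /h mulrAC ler_pdivrMr; lra.
  have [N fN] := blsc_le_nat h0 bf.
  exists (fun x => h * (\sum_(k < N) vol m [set y | h * k%:R < f (x, y)]) + - (h * V)).
    apply: lscD; last exact: lsc_cst.
    apply: lscZ => //; apply: (@lsc_sum _ _ N (fun k x => vol m [set y | h * k%:R < f (x, y)])) => k.
    exact: (@vol_section_lsc _ _ m [set z | h * k%:R < f z] tm (lf _)).
  move=> x.
  have := layers_int m h0 (blsc_section1 x bf) (fun y => fN (x, y)).
  by move: (\int[m]_y _) (h * \sum_(k < N) _) => u v; rewrite -/V; lra.
- by move=> x; apply: Rintegral_ge0 => y _.
- exists (M * vol m setT) => x; rewrite -int_cst; apply: le_int.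
  + exact/blsc_bmeas/blsc_section1.
  + exact: bmeas_cst.
  + by move=> y; exact: fM.
Qed.

Lemma int_section2_blsc (X : ptopologicalType) (Y : topologicalType)
    (m : {finite_measure set (borelType X) -> \bar R}) (f : X * Y -> R) :
  tau_additive m -> blsc f -> blsc (fun y => \int[m]_x f (x, y)).
Proof.
move=> tm bf; apply: (@int_section_blsc _ _ m (fun z => f (z.2, z.1)) tm).
by apply: (@blsc_comp _ _ _ _ f _ bf); exact: continuous_swap.
Qed.

Lemma vol_section_measurable_swap (X Y : ptopologicalType)
    (m1 : {finite_measure set (borelType X) -> \bar R})
    (m2 : {finite_measure set (borelType Y) -> \bar R}) (W : set (X * Y)) :
  measurable (W : set (borelType X * borelType Y)%type) ->
  \int[m1]_x vol m2 [set y | W (x, y)] = \int[m2]_y vol m1 [set x | W (x, y)].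
Proof.
move=> mW; rewrite /Rintegral; congr fine.
have := @indic_fubini_tonelli _ _ _ _ R m1 m2 W mW.
rewrite indic_fubini_tonelli_FE// indic_fubini_tonelli_GE//= => H.
transitivity (\int[m1]_x m2 (xsection W x))%E.
  apply: eq_integral => x _ /=; rewrite -volE; last exact: (@measurable_xsection _ _ (borelType X) (borelType Y)).
  by rewrite xsectionE.
rewrite H; apply: eq_integral => y _ /=; rewrite -volE; last exact: (@measurable_ysection _ _ (borelType X) (borelType Y)).
by rewrite ysectionE.
Qed.

(* The classical theorem applies to the open subsets of [W] that are measurable for
   the product sigma-algebra; they are directed and their union is [W]. *)
Let vol_section_swap_le (X Y : ptopologicalType)
    (m1 : {finite_measure set (borelType X) -> \bar R})
    (m2 : {finite_measure set (borelType Y) -> \bar R}) (W : set (X * Y)) :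
  tau_additive m1 -> tau_additive m2 -> open W ->
  \int[m1]_x vol m2 [set y | W (x, y)] <= \int[m2]_y vol m1 [set x | W (x, y)].
Proof.
move=> t1 t2 oW; apply/ler_addgt0Pr => e e0.
pose P := [set W' : set (X * Y) | [/\ open W',
  measurable (W' : set (borelType X * borelType Y)%type) & W' `<=` W]].
pose I := {W' : set (X * Y) | P W'}.
have I0 : I by exists set0; split=> //; exact: open0.
have dirI (i j : I) : exists k : I, sval i `|` sval j `<=` sval k.
  case: i j => [V1 [oV1 mV1 s1]] [V2 [oV2 mV2 s2]].
  suff h : [/\ open (V1 `|` V2),
      measurable (V1 `|` V2 : set (borelType X * borelType Y)%type) & V1 `|` V2 `<=` W].
    by exists (exist P _ h).
  split; [exact: openU|exact: measurableU|by rewrite subUset].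
have le2 (V V' : set (X * Y)) x : open V -> open V' -> V `<=` V' ->
    vol m2 [set y | V (x, y)] <= vol m2 [set y | V' (x, y)].
  move=> oV oV' VV'; apply: le_vol; [apply: open_measurable_borel; exact: open_section1..|].
  by move=> y /=; exact: VV'.
have [| | | |i Hi] := @directed_int _ m1 I (fun x => vol m2 [set y | W (x, y)])
  (fun i x => vol m2 [set y | sval i (x, y)]) t1 I0 (vol_section1_blsc t2 oW) _ _ _ _ e e0.
- by move=> [V []] /= ? ? ?; exact: vol_section1_blsc.
- move=> i j; have [k] := dirI i j; rewrite subUset => -[ik jk]; exists k => x.
  by case: i j k ik jk => [V1 []] ? ? ? [V2 []] ? ? ? [V3 []] ? ? ? /= ? ?; split; exact: le2.
- by move=> [V [oV mV VW]] x /=; exact: le2.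
- move=> x a ax; apply: (t2 I (fun i => [set y | sval i (x, y)])) => //.
  + by move=> [V []] /= ? ? ?; exact: open_section1.
  + move=> i j; have [k ijk] := dirI i j; exists k => y /= h; exact: ijk.
  + rewrite (_ : \bigcup_i _ = [set y | W (x, y)])//; apply/seteqP; split=> y.
      by move=> [[V [? ? VW]] _ /=]; exact: VW.
    move=> /= Wxy; have : nbhs (x, y) W by exact: open_nbhs_nbhs.
    move=> [[U V] /= [Ux Vy]] UVW.
    suff h : [/\ open (U° `*` V°),
        measurable (U° `*` V° : set (borelType X * borelType Y)%type) & U° `*` V° `<=` W].
      by exists (exist P _ h).
    split.
    * by apply: open_rectangle; exact: open_interior.
    * by apply: measurableX; apply: open_measurable_borel; exact: open_interior.
    * by move=> z [? ?]; apply: UVW; split; exact: interior_subset.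
(* The chosen subset of [W] obeys the classical exchange, and enlarging it back to [W] only
   increases the right-hand side. *)
apply: le_trans Hi _; rewrite lerD2r.
case: i => [V [oV mV VW]] /=; rewrite vol_section_measurable_swap//.
apply: le_int; [apply: blsc_bmeas; exact: vol_section2_blsc..|].
move=> y; apply: le_vol; [apply: open_measurable_borel; exact: open_section2..|].
by move=> x /=; exact: VW.
Qed.

Lemma vol_section_swap (X Y : ptopologicalType)
    (m1 : {finite_measure set (borelType X) -> \bar R})
    (m2 : {finite_measure set (borelType Y) -> \bar R}) (W : set (X * Y)) :
  tau_additive m1 -> tau_additive m2 -> open W ->
  \int[m1]_x vol m2 [set y | W (x, y)] = \int[m2]_y vol m1 [set x | W (x, y)].
Proof.
move=> t1 t2 oW; apply/eqP; rewrite eq_le vol_section_swap_le//=.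
apply: (@vol_section_swap_le _ _ m2 m1 [set z | W (z.2, z.1)]) => //.
by apply: (open_comp _ oW) => z _; exact: continuous_swap.
Qed.

End tonelli.

(** * Exchange of iterated integrals of functions *)

Section iterated.
Context {R : realType}.

(** Both sides are compared with layer sums, whose superlevel sets are open and obey
    [vol_section_swap]. The loss is at most [h * V1 * V2]. *)
Let int_swap_le (X Y : ptopologicalType)
    (m1 : {finite_measure set (borelType X) -> \bar R})
    (m2 : {finite_measure set (borelType Y) -> \bar R}) (f : X * Y -> R) :
  tau_additive m1 -> tau_additive m2 -> blsc f ->
  \int[m1]_x \int[m2]_y f (x, y) <= \int[m2]_y \int[m1]_x f (x, y).
Proof.
move=> t1 t2 bf; apply/ler_addgt0Pr => e e0.
set V1 := vol m1 setT; have V10 : 0 <= V1 := vol_ge0 _ _.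
set V2 := vol m2 setT; have V20 : 0 <= V2 := vol_ge0 _ _.
have VV : 0 <= V1 * V2 by exact: mulr_ge0.
pose h : R := e / (V1 * V2 + 1).
have h0 : 0 < h by rewrite divr_gt0//; lra.
have hV : h * V1 * V2 <= e.
  by rewrite -mulrA /h mulrAC ler_pdivrMr; lra.
have [N fN] := blsc_le_nat h0 bf.
pose W (k : nat) := [set z | h * k%:R < f z].
have oW k : open (W k) by case: bf => lf _ _; exact: lf.
pose S1 n x := \sum_(k < n) vol m2 [set y | W k (x, y)].
pose S2 n y := \sum_(k < n) vol m1 [set x | W k (x, y)].
have b1 n : bmeas (S1 n).
  elim: n => [|n IH].
    by under [S1 0]eq_fun do rewrite /S1 big_ord0; exact: bmeas_cst.
  under [S1 _]eq_fun do rewrite /S1 big_ord_recr /=; apply: bmeasD => //.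
  by apply: blsc_bmeas; exact: vol_section1_blsc.
have b2 n : bmeas (S2 n).
  elim: n => [|n IH].
    by under [S2 0]eq_fun do rewrite /S2 big_ord0; exact: bmeas_cst.
  under [S2 _]eq_fun do rewrite /S2 big_ord_recr /=; apply: bmeasD => //.
  by apply: blsc_bmeas; exact: vol_section2_blsc.
have E n : \int[m1]_x S1 n x = \int[m2]_y S2 n y.
  elim: n => [|n IH].
    under eq_Rintegral do rewrite /S1 big_ord0.
    under [RHS]eq_Rintegral do rewrite /S2 big_ord0.
    by rewrite !int_cst !mul0r.
  under eq_Rintegral do rewrite /S1 big_ord_recr /=.
  under [RHS]eq_Rintegral do rewrite /S2 big_ord_recr /=.
  have c1 := blsc_bmeas (vol_section1_blsc t2 (oW n)).
  have c2 := blsc_bmeas (vol_section2_blsc t1 (oW n)).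
  rewrite (intD m1 (b1 n) c1) (intD m2 (b2 n) c2) IH; congr (_ + _).
  exact: vol_section_swap.
have i2 : bmeas (fun y => \int[m1]_x f (x, y)).
  by apply: blsc_bmeas; exact: int_section2_blsc.
apply: (@le_trans _ _ (\int[m1]_x (h * S1 N x))).
  apply: le_int; [by apply: blsc_bmeas; exact: int_section_blsc|exact: bmeasZ|].
  move=> x; have /andP[] // := layers_int m2 h0 (blsc_section1 x bf) (fun y => fN (x, y)).
rewrite intZ// E -intZ//.
apply: (@le_trans _ _ (\int[m2]_y (\int[m1]_x f (x, y) + h * V1))).
  apply: le_int; [exact: bmeasZ|by apply: bmeasD => //; exact: bmeas_cst|].
  move=> y; have /andP[_] // := layers_int m1 h0 (blsc_section2 y bf) (fun x => fN (x, y)).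
by rewrite (intD m2 i2 (bmeas_cst _ _)) int_cst lerD2l.
Qed.

Lemma int_swap (X Y : ptopologicalType)
    (m1 : {finite_measure set (borelType X) -> \bar R})
    (m2 : {finite_measure set (borelType Y) -> \bar R}) (f : X * Y -> R) :
  tau_additive m1 -> tau_additive m2 -> blsc f ->
  \int[m1]_x \int[m2]_y f (x, y) = \int[m2]_y \int[m1]_x f (x, y).
Proof.
move=> t1 t2 bf; apply/eqP; rewrite eq_le int_swap_le//=.
apply: (@int_swap_le _ _ m2 m1 (fun z => f (z.2, z.1))) => //.
by apply: (@blsc_comp _ _ _ _ f _ bf); exact: continuous_swap.
Qed.

(** Exchange [x] with [y], then [x] with [z] for fixed [y]. This is how the outermost variable gets
    integrated first. *)
Lemma vol_section_rotate (X Y Z : ptopologicalType)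
    (m1 : {finite_measure set (borelType X) -> \bar R})
    (m2 : {finite_measure set (borelType Y) -> \bar R})
    (m3 : {finite_measure set (borelType Z) -> \bar R}) (W : set (X * Y * Z)) :
  tau_additive m1 -> tau_additive m2 -> tau_additive m3 -> open W ->
  \int[m1]_x \int[m2]_y vol m3 [set z | W (x, y, z)] =
  \int[m2]_y \int[m3]_z vol m1 [set x | W (x, y, z)].
Proof.
move=> t1 t2 t3 oW.
rewrite (@int_swap _ _ m1 m2 (fun p => vol m3 [set z | W (p, z)]))//; last first.
  exact: vol_section1_blsc.
apply: eq_Rintegral => y _.
apply: (@vol_section_swap _ _ _ m1 m3 [set p | W (p.1, y, p.2)]) => //.
apply: (open_comp _ oW) => z _.
apply: (@continuous_pair _ _ _ (fun p : X * Z => (p.1, y)) snd); last exact: continuous_snd.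
by apply: continuous_pair; [exact: continuous_fst|move=> ?; exact: cvg_cst].
Qed.

Lemma vol_section_first_blsc (X : ptopologicalType) (Y Z : topologicalType)
    (m : {finite_measure set (borelType X) -> \bar R}) (W : set (X * Y * Z)) :
  tau_additive m -> open W -> blsc (fun p : Y * Z => vol m [set x | W (x, p.1, p.2)]).
Proof.
move=> tm oW; apply: (@vol_section2_blsc _ _ _ m [set q | W (q.1, q.2.1, q.2.2)]) => //.
apply: (open_comp _ oW) => z _.
apply: (@continuous_pair _ _ _ (fun p : X * (Y * Z) => (p.1, p.2.1)) (fun p => p.2.2)).
  apply: continuous_pair; first exact: continuous_fst.
  by move=> q; apply: (@continuous_comp _ _ _ snd fst); [exact: continuous_snd|exact: continuous_fst].
by move=> q; apply: (@continuous_comp _ _ _ snd snd); exact: continuous_snd.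
Qed.

End iterated.

(** * Dependent random choice *)

Section graph.
Context {R : realType} {X Y : ptopologicalType}.
Variables (nu : {finite_measure set (borelType X) -> \bar R})
          (la : {finite_measure set (borelType Y) -> \bar R}).
Hypotheses (tnu : tau_additive nu) (tla : tau_additive la).

Definition codeg (Gam : set (X * Y)) (x x' : X) : R :=
  vol la [set y | Gam (x, y) /\ Gam (x', y)].

Lemma open_codeg (Gam : set (X * Y)) (t : R) : open Gam ->
  open [set p | t < codeg Gam p.1 p.2].
Proof.
move=> oG; apply: (@vol_section_lsc _ _ _ la [set q | Gam (q.1.1, q.2) /\ Gam (q.1.2, q.2)]) => //.
have c1 : continuous (fun q : X * X * Y => (q.1.1, q.2)).
  apply: continuous_pair; last exact: continuous_snd.
  by move=> q; apply: (@continuous_comp _ _ _ fst fst); exact: continuous_fst.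
have c2 : continuous (fun q : X * X * Y => (q.1.2, q.2)).
  apply: continuous_pair; last exact: continuous_snd.
  move=> q; apply: (@continuous_comp _ _ _ fst snd); first exact: continuous_fst.
  exact: continuous_snd.
apply: openI.
  by apply: (open_comp _ oG) => z _; exact: c1.
by apply: (open_comp _ oG) => z _; exact: c2.
Qed.

(** Take [y] at random. Its neighbourhood has mean volume at least [th * al], so mean squared volume
    at least [(th * al)^2]. A pair of codegree at most [t] lies in the neighbourhood with
    probability at most [t / be], so such pairs have mean volume at most [eps (th * al)^2 / 2]. Some
    [y] does at least as well as the average of the difference. *)
Lemma dependent_random_choice (Gam : set (X * Y)) (th eps t : R) :
  open Gam -> 0 < th -> 0 < eps -> 0 < vol nu setT -> 0 < vol la setT ->
  t = eps * th ^+ 2 * vol la setT / 2 ->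
  th * vol nu setT * vol la setT <= \int[nu]_x vol la [set y | Gam (x, y)] ->
  exists y, let N := [set x | Gam (x, y)] in
    2 / 3 * th * vol nu setT < vol nu N /\
    (1 - eps) * vol nu N ^+ 2 <
      \int[nu]_x vol nu [set x' | (N x /\ N x') /\ t < codeg Gam x x'].
Proof.
move=> oG th0 eps0 al0 be0 tE dens.
set al := vol nu setT in al0 dens *; set be := vol la setT in be0 tE dens.
pose n y := vol nu [set x | Gam (x, y)].
have bn : bmeas n by apply: blsc_bmeas; exact: vol_section2_blsc.
have n0 y : 0 <= n y := vol_ge0 _ _.
have cG1 : continuous (fun q : Y * X * X => (q.1.2, q.1.1)).
  by move=> q; apply: (@continuous_comp _ _ _ fst (fun z : Y * X => (z.2, z.1)));
    [exact: continuous_fst|exact: continuous_swap].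
have cG2 : continuous (fun q : Y * X * X => (q.2, q.1.1)).
  apply: continuous_pair; first exact: continuous_snd.
  by move=> q; apply: (@continuous_comp _ _ _ fst fst); exact: continuous_fst.
have cC : continuous (fun q : Y * X * X => (q.1.2, q.2)).
  apply: continuous_pair; last exact: continuous_snd.
  by move=> q; apply: (@continuous_comp _ _ _ fst snd); [exact: continuous_fst|exact: continuous_snd].
pose W0 := [set q : Y * X * X | Gam (q.1.2, q.1.1) /\ Gam (q.2, q.1.1)].
have oW0 : open W0.
  apply: openI; first by apply: (open_comp _ oG) => z _; exact: cG1.
  by apply: (open_comp _ oG) => z _; exact: cG2.
pose W := W0 `&` [set q : Y * X * X | t < codeg Gam q.1.2 q.2].
have oW : open W.
  apply: openI => //; apply: (@open_comp _ _ (fun q : Y * X * X => (q.1.2, q.2)) [set p : X * X | t < codeg Gam p.1 p.2] _ (@open_codeg Gam t oG)) => z _.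
  exact: cC.
pose G y := \int[nu]_x vol nu [set x' | W (y, x, x')].
have bG : bmeas G.
  apply: blsc_bmeas; apply: (@int_section_blsc _ _ _ nu (fun p => vol nu [set x' | W (p, x')])) => //.
  exact: vol_section1_blsc.
have secW0 y x : [set x' | W0 (y, x, x')] = if x \in [set x | Gam (x, y)] then [set x | Gam (x, y)] else set0.
  case: ifPn => [/set_mem /= xy|/negP xy]; apply/seteqP; split=> x' //=.
    by case.
  by case=> /= h; case: xy; exact/mem_set.
have volW0 y x : vol nu [set x' | W0 (y, x, x')] = n y * \1_[set x | Gam (x, y)] x.
  rewrite secW0 indicE; case: ifP => _ /=; first by rewrite mulr1.
  by rewrite /vol measure0 mulr0.
have oGy y : measurable ([set x | Gam (x, y)] : set (borelType X)).
  by apply: open_measurable_borel; exact: open_section2.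
have int0 y : \int[nu]_x vol nu [set x' | W0 (y, x, x')] = n y ^+ 2.
  under eq_Rintegral do rewrite volW0.
  by rewrite intZ ?int_indic//; exact: bmeas_indic.
have bxx (x : X) (V : set (Y * X * X)) : open V ->
    blsc (fun x' => vol la [set y | V (y, x, x')]).
  by move=> oV; exact: (blsc_section1 x (vol_section_first_blsc tla oV)).
have bx (V : set (Y * X * X)) : open V ->
    blsc (fun x => \int[nu]_x' vol la [set y | V (y, x, x')]).
  by move=> oV; exact: (int_section_blsc tnu (vol_section_first_blsc tla oV)).
(* With [y] integrated first, a pair of codegree above [t] loses nothing in passing from [W0] to
   [W], and any other pair loses its codegree, at most [t]. *)
have intG : \int[la]_y (n y ^+ 2) - t * al ^+ 2 <= \int[la]_y G y.
  under eq_Rintegral do rewrite -int0.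
  rewrite /G !vol_section_rotate//.
  rewrite (_ : t * al ^+ 2 = \int[nu]__ (t * al)); last by rewrite int_cst mulrA.
  rewrite -intB; [|by apply: blsc_bmeas; exact: bx|exact: bmeas_cst].
  apply: le_int.
  - by apply: bmeasB; [apply: blsc_bmeas; exact: bx|exact: bmeas_cst].
  - by apply: blsc_bmeas; exact: bx.
  move=> x /=.
  rewrite -int_cst -intB; [|by apply: blsc_bmeas; exact: bxx|exact: bmeas_cst].
  apply: le_int.
  - by apply: bmeasB; [apply: blsc_bmeas; exact: bxx|exact: bmeas_cst].
  - by apply: blsc_bmeas; exact: bxx.
  move=> x' /=; have [tc|tc] := ltP t (codeg Gam x x').
    rewrite (_ : [set y | W _] = [set y | W0 (y, x, x')]); last first.
      by apply/seteqP; split=> y /=; [case|].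
    by have := mulr_gt0 (mulr_gt0 eps0 (exprn_gt0 2 th0)) be0; lra.
  apply: (@le_trans _ _ 0); last exact: vol_ge0.
  by rewrite subr_le0.
have intn : th * al * be <= \int[la]_y n y.
  by rewrite -(@vol_section_swap _ _ _ nu la Gam).
have bn2 : bmeas (fun y => n y ^+ 2) by exact: bmeasM.
(* Cauchy-Schwarz, by integrating [(n y - th * al)^2 >= 0]. *)
have intn2 : (th * al) ^+ 2 * be <= \int[la]_y (n y ^+ 2).
  have [q qE] : exists q, q = th * al * (th * al) by eexists.
  rewrite expr2 -qE.
  have : \int[la]_y (2 * (th * al) * n y - q) <= \int[la]_y (n y ^+ 2).
    apply: le_int => //; first by apply: bmeasB; [exact: bmeasZ|exact: bmeas_cst].
    by move=> y; rewrite /= qE; have := sqr_ge0 (n y - th * al); nra.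
  rewrite (intB la (bmeasZ _ bn) (bmeas_cst _ _)) intZ// int_cst -/be.
  have : q * be <= th * al * \int[la]_y n y.
    by rewrite qE -mulrA ler_wpM2l// ltW// mulr_gt0.
  by set v := Rintegral _ _ _; set w := Rintegral _ _ _; lra.
have G_le y : G y <= n y ^+ 2.
  rewrite -int0; apply: le_int.
  - apply: blsc_bmeas; apply: (@vol_section1_blsc _ _ _ nu [set p | W (y, p.1, p.2)]) => //.
    apply: (open_comp _ oW) => z _.
    apply: (@continuous_pair _ _ _ (fun p : X * X => (y, p.1)) snd); last exact: continuous_snd.
    by apply: continuous_pair; [move=> ?; exact: cvg_cst|exact: continuous_fst].
  - under eq_fun do rewrite volW0.
    by apply: bmeasZ; exact: bmeas_indic.
  - move=> x; apply: le_vol.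
    + by apply: open_measurable_borel; exact: (@open_section1 _ _ W (y, x)).
    + by apply: open_measurable_borel; exact: (@open_section1 _ _ W0 (y, x)).
    + by move=> x' [].
(* The square of the required bound [2 / 3 * th * al]. The average of the difference is at least
   [eps / 2 * (th * al)^2], which beats [eps * c] because [4 / 9 < 1 / 2]. *)
pose c := 4 / 9 * (th * al) ^+ 2.
have c0 : 0 < c by rewrite !mulr_gt0// ?exprn_gt0 ?mulr_gt0.
have [y Hy] : exists y, eps * c < eps * n y ^+ 2 - (n y ^+ 2 - G y).
  apply: contrapT => /forallNP H.
  have : \int[la]_y (eps * n y ^+ 2 - (n y ^+ 2 - G y)) <= \int[la]__ (eps * c).
    apply: le_int; [|exact: bmeas_cst|by move=> y; move/negP: (H y); rewrite -leNgt].
    by apply: bmeasB; [exact: bmeasZ|exact: bmeasB].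
  rewrite (intB la (bmeasZ _ bn2) (bmeasB bn2 bG)) (intB la bn2 bG) intZ//.
  rewrite int_cst -/be => H1.
  have := ler_wpM2l (ltW eps0) intn2.
  have : 0 < eps * ((th * al) ^+ 2 * be) by rewrite !mulr_gt0// exprn_gt0// mulr_gt0.
  move: H1 intG; rewrite tE /c; set u := \int[la]_y (n y ^+ 2); set v := \int[la]_y G y.
  by lra.
exists y => /=; split.
  rewrite -/(n y) -(@ltr_pXn2r _ 2)// ?nnegrE//; last first.
    by rewrite !mulr_ge0// ltW.
  have : eps * c < eps * n y ^+ 2 by have := G_le y; lra.
  by rewrite ltr_pM2l// /c; apply: le_lt_trans; lra.
rewrite -/(n y); have : 0 < eps * c by exact: mulr_gt0.
by move: Hy; rewrite /G /W /=; lra.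
Qed.

End graph.

(** * Paths of length three in a dense bipartite graph *)

Section paths.
Context {R : realType} {X Y : ptopologicalType}.
Variables (nu : {finite_measure set (borelType X) -> \bar R})
          (la : {finite_measure set (borelType Y) -> \bar R}).
Hypotheses (tnu : tau_additive nu) (tla : tau_additive la).

(** Inclusion-exclusion inside [N], by comparing indicators pointwise. *)
Lemma vol_inter_ge (U V N : set X) : open U -> open V -> open N ->
  U `<=` N -> V `<=` N -> vol nu U + vol nu V <= vol nu N + vol nu (U `&` V).
Proof.
move=> oU oV oN UN VN.
have mb (W : set X) : open W -> measurable (W : set (borelType X)).
  exact: open_measurable_borel.
have ib (W : set X) : open W -> bmeas (\1_W : X -> R).
  by move=> /mb; exact: bmeas_indic.
have oUV : open (U `&` V) by exact: openI.
rewrite -(int_indic nu (mb _ oU)) -(int_indic nu (mb _ oV)) -(int_indic nu (mb _ oN)).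
rewrite -(int_indic nu (mb _ oUV)) -(intD nu (ib _ oU) (ib _ oV)).
rewrite -(intD nu (ib _ oN) (ib _ oUV)); apply: le_int.
- by apply: bmeasD; exact: ib.
- by apply: bmeasD; exact: ib.
move=> x; rewrite !indicE in_setI.
case: (boolP (x \in U)) => [/set_mem /UN Nx|_] /=.
  by rewrite (mem_set Nx).
case: (boolP (x \in V)) => [/set_mem /VN Nx|_] /=.
  by rewrite (mem_set Nx) addr0 add0r.
by rewrite !addr0 ler0n.
Qed.

(** Inside the neighbourhood [N] given by dependent random choice, [A'] collects the points forming
    a good pair with more than a share [1 - dl / 8] of [N], and [B'] the points adjacent to more
    than a share [dl / 4] of [N]. For [x] in [A'] and [y] in [B'] these two parts of [N] must
    overlap, and every [x'] in the overlap is a middle vertex of many paths. *)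
Lemma dense_graph_paths (Gam : set (X * Y)) (dl : R) :
  open Gam -> 0 < dl -> 0 < vol nu setT -> 0 < vol la setT ->
  dl * vol nu setT * vol la setT <= \int[nu]_x vol la [set y | Gam (x, y)] ->
  exists (A' : set X) (B' : set Y), [/\ open A', open B',
    dl * vol nu setT / 4 <= vol nu A', dl * vol la setT / 4 <= vol la B' &
    forall x y, A' x -> B' y -> dl ^+ 2 * vol nu setT / 24 <=
      vol nu [set x' | Gam (x', y) /\ dl ^+ 3 * vol la setT / 256 < codeg la Gam x x']].
Proof.
move=> oG dl0 al0 be0 dens.
set al := vol nu setT in al0 dens *; set be := vol la setT in be0 dens *.
have mX (W : set X) : open W -> measurable (W : set (borelType X)).
  exact: open_measurable_borel.
have mY (W : set Y) : open W -> measurable (W : set (borelType Y)).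
  exact: open_measurable_borel.
pose d x := vol la [set y | Gam (x, y)].
have bd : blsc d by exact: vol_section1_blsc.
(* Restricting to vertices of large degree makes [B'] large in the end: every
   vertex of the neighbourhood [N] chosen below then has many neighbours. *)
pose At := [set x | dl * be / 2 < d x].
have oAt : open At by case: bd => ld _ _; exact: ld.
pose Gam' := Gam `&` [set z | At z.1].
have oG' : open Gam'.
  by apply: openI => //; apply: (open_comp _ oAt) => z _; exact: continuous_fst.
pose d' x := vol la [set y | Gam' (x, y)].
have bd' : bmeas d' by apply: blsc_bmeas; exact: vol_section1_blsc.
have d_le x : d x <= d' x + dl * be / 2.
  have [Ax|/negP Ax] := pselect (At x).
    rewrite (_ : d x = d' x); first by rewrite lerDl divr_ge0// mulr_ge0// ltW.
    by rewrite /d /d'; congr (vol la _); apply/seteqP; split=> y /=; [|case].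
  have := vol_ge0 la [set y | Gam' (x, y)]; rewrite -/(d' x).
  by move: Ax; rewrite /At /=; case: ltP => //; lra.
(* Each removed vertex had degree at most [dl * be / 2], so at least half of the density
   survives. *)
have dens' : dl / 2 * al * be <= \int[nu]_x d' x.
  have : \int[nu]_x d x <= \int[nu]_x (d' x + dl * be / 2).
    by apply: le_int => //; [exact: blsc_bmeas|apply: bmeasD => //; exact: bmeas_cst].
  rewrite (intD nu bd' (bmeas_cst _ (dl * be / 2))) int_cst -/al.
  have : dl * al * be <= \int[nu]_x d x by exact: dens.
  by set u := \int[nu]_x d x; set v := \int[nu]_x d' x; lra.
have [| | | y0 [/= ]] := @dependent_random_choice _ _ _ nu la tnu tla Gam' (dl / 2) (dl / 32)
  (dl ^+ 3 * be / 256) oG' _ _ al0 be0 _ dens'.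
- lra.
- lra.
- by rewrite -/be; field.
set N := [set x | _]; set n := vol nu N; rewrite -/al => n_gt.
set t := dl ^+ 3 * be / 256.
have oN : open N by exact: open_section2.
have n0 : 0 < n by apply: lt_trans n_gt; rewrite !mulr_gt0.
pose good := [set p : X * X | (N p.1 /\ N p.2) /\ t < codeg la Gam' p.1 p.2].
have ogood : open good.
  apply: openI; last exact: (@open_codeg _ _ _ la tla Gam' t oG').
  apply: openI.
    by apply: (open_comp _ oN) => z _; exact: continuous_fst.
  by apply: (open_comp _ oN) => z _; exact: continuous_snd.
pose g x := vol nu [set x' | good (x, x')].
rewrite -[X in _ < X]/(\int[nu]_x g x) => int_g.
have bg : blsc g by exact: vol_section1_blsc.
have oS x : open [set x' | good (x, x')] by exact: open_section1.
pose A' := N `&` [set x | (1 - dl / 8) * n < g x].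
have oA' : open A' by apply: openI => //; case: bg => lg _ _; exact: lg.
pose h y := vol nu [set x | Gam (x, y) /\ N x].
have oGN : open [set z | Gam z /\ N z.1].
  by apply: openI => //; apply: (open_comp _ oN) => z _; exact: continuous_fst.
have bh : blsc h by exact: (@vol_section2_blsc _ _ _ nu [set z | Gam z /\ N z.1]).
pose B' := [set y | dl * n / 4 < h y].
have oB' : open B' by case: bh => lh _ _; exact: lh.
have iN : bmeas (\1_N : X -> R) by apply: bmeas_indic; exact: mX.
have iA : bmeas (\1_A' : X -> R) by apply: bmeas_indic; exact: mX.
have iB : bmeas (\1_B' : Y -> R) by apply: bmeas_indic; exact: mY.
have g_le x : g x <= n by apply: le_vol; [exact: mX|exact: mX|move=> x' [[]]].
have h_le y : h y <= n.
  by apply: le_vol; [apply: mX; exact: (@open_section2 _ _ _ y oGN)|exact: mX|move=> x' []].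
(* Markov: the pairs of [N] that are not good have volume below [dl / 32 * n^2], while each point of
   [N] outside [A'] accounts for at least [dl / 8 * n] of it. *)
have volA : 3 / 4 * n <= vol nu A'.
  have : \int[nu]_x g x <= \int[nu]_x ((1 - dl / 8) * n * \1_N x + dl / 8 * n * \1_A' x).
    apply: le_int; [exact: blsc_bmeas|by apply: bmeasD; exact: bmeasZ|].
    move=> x; rewrite !indicE; case: (boolP (x \in N)) => [/set_mem Nx|/negP Nx] /=.
      case: (boolP (x \in A')) => [_|/negP Ax] /=; first by have := g_le x; lra.
      rewrite mulr1 mulr0 addr0 leNgt; apply/negP => gx; apply: Ax; exact/mem_set.
    rewrite (_ : x \in A' = false); last first.
      by apply/negP => /set_mem [Nx' _]; apply: Nx; exact/mem_set.
    rewrite !mulr0 addr0 /g (_ : [set x' | _] = set0) ?/vol ?measure0//.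
    by apply/seteqP; split=> x' //= [[/= Nx' _] _]; apply: Nx; exact/mem_set.
  rewrite (intD nu (bmeasZ ((1 - dl / 8) * n) iN) (bmeasZ (dl / 8 * n) iA)) !intZ// (int_indic nu (mX _ oN)) (int_indic nu (mX _ oA')) -/n.
  move/(lt_le_trans int_g) => H.
  have : (dl * n / 32) * (3 * n - 4 * vol nu A') < 0 by move: H; lra.
  by rewrite pmulr_rlt0 ?divr_gt0 ?mulr_gt0//; lra.
(* Edges leaving [N] are counted twice: every vertex of [N] has degree above [dl * be / 2], while
   [h] is at most [n] on [B'] and at most [dl * n / 4] elsewhere. *)
have volB : dl * be / 4 <= vol la B'.
  have H1 : dl * be * n / 2 <= \int[la]_y h y.
    rewrite -(@vol_section_swap _ _ _ nu la [set z | Gam z /\ N z.1])//.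
    rewrite (_ : dl * be * n / 2 = \int[nu]_x (dl * be / 2 * \1_N x)); last first.
      by rewrite intZ// (int_indic nu (mX _ oN)) -/n; lra.
    apply: le_int; [exact: bmeasZ|by apply: blsc_bmeas; exact: vol_section1_blsc|].
    move=> x; rewrite indicE; case: (boolP (x \in N)) => [/set_mem Nx|_] /=.
      rewrite mulr1 (_ : [set y | _] = [set y | Gam (x, y)]).
        by case: Nx => _ /= /ltW.
      by apply/seteqP; split=> y /=; [case|].
    by rewrite mulr0 vol_ge0.
  have : \int[la]_y h y <= \int[la]_y (n * \1_B' y + dl * n / 4).
    apply: le_int; [exact: blsc_bmeas|by apply: bmeasD; [exact: bmeasZ|exact: bmeas_cst]|].
    move=> y; rewrite indicE; case: (boolP (y \in B')) => [_|/negP By] /=.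
      by rewrite mulr1 (le_trans (h_le y))// lerDl divr_ge0// mulr_ge0// ltW.
    by rewrite mulr0 add0r leNgt; apply/negP => hy; apply: By; exact/mem_set.
  rewrite (intD la (bmeasZ n iB) (bmeas_cst _ (dl * n / 4))) intZ// int_cst (int_indic la (mY _ oB')) -/be.
  move/(le_trans H1) => H.
  have : 0 <= n * (vol la B' - dl * be / 4) by move: H; lra.
  by rewrite pmulr_rge0//; lra.
exists A', B'; split => //.
  by apply: le_trans volA; lra.
move=> x y [Nx gx] By.
have oGNy := @open_section2 _ _ _ y oGN.
(* The overlap has volume at least [dl * n / 8], and [n > dl * al / 3] makes this at least
   [dl^2 * al / 24]. *)
have := vol_inter_ge (oS x) oGNy oN (fun x' => (fun h => h.1.2)) (fun x' => (fun h => h.2)).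
have : vol nu ([set x' | good (x, x')] `&` [set x' | Gam (x', y) /\ N x']) <=
    vol nu [set x' | Gam (x', y) /\ t < codeg la Gam x x'].
  apply: le_vol.
  - by apply: mX; exact: openI.
  - apply: mX; apply: openI; first exact: open_section2.
    exact: (@open_section1 _ _ _ x (@open_codeg _ _ _ la tla Gam t oG)).
  move=> x' /= [[[_ _] tc] [Gx' _]]; split=> //; apply: lt_le_trans tc _.
  have oc (V : set (X * Y)) : open V -> open [set y | V (x, y) /\ V (x', y)].
    by move=> oV; apply: openI; exact: open_section1.
  apply: le_vol; [apply: mY; exact: oc|apply: mY; exact: oc|].
  by move=> z [[? _] [? _]].
rewrite -/n -/(g x) -/(h y).
by move: gx By; rewrite /B' /=; nra.
Qed.

End paths.

(** * Invariant Radon measures on a topological group *)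

Section group.
Context {R : realType} {G : topologicalGroupType}.
Variable mu : {measure set (borelType G) -> \bar R}.
Implicit Types (A B U V E : set G).

(** Directedness merges a finite subcover into one member. Here compactness is used in its
    near-covering form, with the filter generated by the sets of indices [j] such that [F j]
    contains a given [F i]. *)
Lemma compact_directed (X : topologicalType) (K : set X) (I : Type) (F : I -> set X) :
  compact K -> I -> (forall i, open (F i)) ->
  (forall i j, exists k, F i `|` F j `<=` F k) ->
  K `<=` \bigcup_i F i -> exists i, K `<=` F i.
Proof.
move=> /compact_near_coveringP cK i0 oF dF KF.
pose FF : set_system I := [set S | exists i, forall j, F i `<=` F j -> S j].
have fFF : Filter FF.
  split.
  - by exists i0.
  - move=> S T [i Si] [j Tj]; have [k] := dF i j; rewrite subUset => -[ik jk].
    by exists k => l kl; split; [apply: Si|apply: Tj]; exact: subset_trans kl.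
  - by move=> S T ST [i Si]; exists i => j /Si/ST.
have [|i Hi] := cK I FF (fun i x => F i x) fFF _.
- move=> x /KF[i _ Fix]; exists (F i, [set j | F i `<=` F j]).
    by split; [apply: open_nbhs_nbhs; split; first exact: oF|exists i].
  by move=> [x' j] /= [Fx' Fij]; exact: Fij.
by exists i; exact: Hi.
Qed.

Lemma mulg_comp_continuous (X : topologicalType) (f g : X -> G) :
  continuous f -> continuous g -> continuous (fun x => f x * g x)%g.
Proof.
move=> cf cg x.
apply: (@continuous_comp _ _ _ (fun x => (f x, g x)) (fun p : G * G => (p.1 * p.2)%g)).
  by apply: continuous_pair.
exact: mulg_continuous.
Qed.

Lemma invg_comp_continuous (X : topologicalType) (f : X -> G) :
  continuous f -> continuous (fun x => (f x)^-1)%g.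
Proof.
move=> cf x; apply: (@continuous_comp _ _ _ f (fun y : G => (y^-1)%g)); first exact: cf.
exact: invg_continuous.
Qed.

Lemma cst_continuous (X : topologicalType) (c : G) : continuous (fun _ : X => c).
Proof. by move=> x; exact: cvg_cst. Qed.

Lemma id_continuous (X : topologicalType) : continuous (fun x : X => x).
Proof. by move=> x; exact: cvg_id. Qed.

Lemma open_preimage (X Y : topologicalType) (f : X -> Y) (U : set Y) :
  continuous f -> open U -> open [set x | U (f x)].
Proof. by move=> cf oU; apply: (open_comp _ oU) => x _; exact: cf. Qed.

Lemma open_product_set A B : open B -> open (product_set A B).
Proof.
move=> oB.
rewrite (_ : product_set A B = \bigcup_(a in A) [set x | B (a^-1 * x)%g]).
  apply: bigcup_open => a _; apply: open_preimage => //.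
  by apply: mulg_comp_continuous; [exact: cst_continuous|exact: id_continuous].
apply/seteqP; split=> x.
  by move=> [a Aa [b Bb <-]]; exists a => //=; rewrite mulKg.
by move=> [a Aa /= Bx]; exists a => //; exists (a^-1 * x)%g => //; rewrite mulVKg.
Qed.

Hypothesis Hmu : multiplicative_group mu.

(** Inner regularity gives a compact subset of the union, within [U], of measure above [a]; by
    [compact_directed] a single [F i] contains it. *)
Lemma radon_restr_tau U (mU : measurable (U : set (borelType G))) (fU : (mu U < +oo)%E) :
  open U -> tau_additive (mfrestr mU fU).
Proof.
move=> oU I F i0 oF dF a aF.
have oFU : open (\bigcup_i F i) by apply: bigcup_open.
have oI V : open V -> open (V `&` U) by move=> oV; exact: openI.
have : (a%:E < mu (\bigcup_i F i `&` U))%E.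
  rewrite -[X in (_ < X)%E](volE (mfrestr mU fU) (open_measurable_borel oFU)).
  by rewrite lte_fin.
rewrite (radon_inner (mulgroup_radon Hmu))//; last exact: oI.
move=> /ereal_sup_gt[_ [K [cK mK KF] <-] aK].
have [|i Ki] := @compact_directed _ K I F cK i0 oF dF.
  by move=> x /KF[].
exists i; rewrite -lte_fin (volE _ (open_measurable_borel (oF i))).
apply: lt_le_trans aK _; apply: (@le_measure _ _ _ mu K (F i `&` U)); rewrite ?inE //.
- by apply: open_measurable_borel; exact: oI.
- by move=> x Kx; split; [exact: Ki|case: (KF _ Kx)].
Qed.

Lemma measure_left E (x : G) : measurable (E : set (borelType G)) ->
  mu [set y | E (x * y)%g] = mu E.
Proof.
move=> mE; rewrite -[RHS](mulgroup_left Hmu x^-1%g mE); congr (mu _).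
apply/seteqP; split=> y /=; first by move=> Ey; exists (x * y)%g => //; rewrite mulKg.
by move=> [z Ez <-]; rewrite mulVKg.
Qed.

Lemma measure_right E (x : G) : measurable (E : set (borelType G)) ->
  mu [set y | E (y * x)%g] = mu E.
Proof.
move=> mE; rewrite -[RHS](mulgroup_right Hmu x^-1%g mE); congr (mu _).
apply/seteqP; split=> y /=; first by move=> Ey; exists (y * x)%g => //; rewrite mulgK.
by move=> [z Ez <-]; rewrite mulgVK.
Qed.

Lemma measure_inv E : measurable (E : set (borelType G)) ->
  mu [set y | E (y^-1)%g] = mu E.
Proof.
move=> mE; rewrite -[RHS](mulgroup_inv Hmu mE); congr (mu _).
apply/seteqP; split=> y /=; first by move=> Ey; exists (y^-1)%g => //; rewrite invgK.
by move=> [z Ez <-]; rewrite invgK.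
Qed.

(** The compact set containing [A] is also closed, hence Borel, as [radon_compact] requires. *)
Lemma precompact_finite A : open A -> precompact A -> (mu A < +oo)%E.
Proof.
move=> oA [K AK [cK clK]].
have mK : measurable (K : set (borelType G)).
  rewrite -(setCK K); apply: measurableC; apply: open_measurable_borel.
  exact: closed_openC.
apply: le_lt_trans (radon_compact (mulgroup_radon Hmu) cK mK).
by apply: le_measure; rewrite ?inE//; exact: open_measurable_borel.
Qed.

(** Left translates of [A] are open, have finite measure and cover [K]; open sets of finite measure
    form a directed family. *)
Lemma compact_open_finite K A : open A -> A !=set0 -> (mu A < +oo)%E -> compact K ->
  exists2 U, open U /\ (mu U < +oo)%E & K `<=` U.
Proof.
move=> oA [a Aa] fA cK.
pose P := [set U : set G | open U /\ (mu U < +oo)%E].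
have [||||[U PU] KU] := @compact_directed _ K {U | P U} (fun i => sval i) cK.
- by exists set0; split; [exact: open0|rewrite measure0].
- by move=> [U []].
- move=> [U [oU fU]] [V [oV fV]].
  suff h : P (U `|` V) by exists (exist P _ h).
  split; first exact: openU.
  apply: le_lt_trans (measureU2 _ _ _) _; [exact: open_measurable_borel..|].
  by rewrite lte_add_pinfty.
- move=> x _.
  have oxA : open [set y | A (a * x^-1 * y)%g].
    apply: open_preimage => //.
    by apply: mulg_comp_continuous; [exact: cst_continuous|exact: id_continuous].
  have PxA : P [set y | A (a * x^-1 * y)%g].
    by split=> //; rewrite measure_left//; exact: open_measurable_borel.
  by exists (exist P _ PxA) => //=; rewrite mulgVK.
by exists U.
Qed.

(** The product of the two compact hulls is compact but may fail to be Borel, hence the detour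
    through an open set of finite measure around it. *)
Lemma product_set_finite A B : multiplicative_set A -> multiplicative_set B ->
  (mu (product_set A B) < +oo)%E.
Proof.
move=> [A0 oA pA] [_ oB [KB BKB [cKB _]]].
have fA := precompact_finite oA pA.
have [KA AKA [cKA _]] := pA.
have cK : compact [set (p.1 * p.2)%g | p in KA `*` KB].
  apply: continuous_compact; last exact: compact_setX.
  by apply: continuous_subspaceT; exact: mulg_continuous.
have [U [oU fU] KU] := compact_open_finite oA A0 fA cK.
apply: le_lt_trans fU; apply: le_measure; rewrite ?inE.
- by apply: open_measurable_borel; exact: open_product_set.
- exact: open_measurable_borel.
- move=> x [a Aa [b Bb <-]]; apply: KU; exists (a, b) => //; split; [exact: AKA|exact: BKB].
Qed.

End group.

(** * Popular products and the counting of representations *)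

Section energy.
Context {R : realType} {G : topologicalGroupType}.
Variable mu : {measure set (borelType G) -> \bar R}.
Implicit Types (U V W : set G).

Lemma fine_measure_le V W : open V -> open W -> (mu W < +oo)%E -> V `<=` W ->
  fine (mu V) <= fine (mu W).
Proof.
move=> oV oW fW VW.
have H : (mu V <= mu W)%E.
  by apply: le_measure; rewrite ?inE//; exact: open_measurable_borel.
by apply: fine_le => //; rewrite ge0_fin_numE// (le_lt_trans H).
Qed.

Lemma vol_restr_sub U (mU : measurable (U : set (borelType G))) (fU : (mu U < +oo)%E) V :
  V `<=` U -> vol (mfrestr mU fU) V = fine (mu V).
Proof. by move=> VU; rewrite /vol /= /mfrestr /mrestr setIidl. Qed.

Lemma vol_restr_le U (mU : measurable (U : set (borelType G))) (fU : (mu U < +oo)%E) V :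
  open U -> open V -> (mu V < +oo)%E -> vol (mfrestr mU fU) V <= fine (mu V).
Proof.
move=> oU oV fV; rewrite -[leLHS]/(fine (mu (V `&` U))).
by apply: fine_measure_le => //; exact: openI.
Qed.

Hypothesis Hmu : multiplicative_group mu.
Variables (A B : set G).
Hypotheses (mA : multiplicative_set A) (mB : multiplicative_set B).

Let C := product_set A B.
Let oA : open A. Proof. by case: mA. Qed.
Let oB : open B. Proof. by case: mB. Qed.
Let oC : open C. Proof. exact: open_product_set. Qed.
Let fA : (mu A < +oo)%E. Proof. by case: mA => _ ? ?; exact: precompact_finite. Qed.
Let fB : (mu B < +oo)%E. Proof. by case: mB => _ ? ?; exact: precompact_finite. Qed.
Let fC : (mu C < +oo)%E. Proof. exact: product_set_finite. Qed.

(** The measure [mu] may be infinite, whereas its restrictions to [A], [B] and [C] are finite and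
    tau-additive, as the exchange of integrals demands. *)
Local Notation nA := (mfrestr (open_measurable_borel oA) fA).
Local Notation nB := (mfrestr (open_measurable_borel oB) fB).
Local Notation nC := (mfrestr (open_measurable_borel oC) fC).
Local Notation al := (fine (mu A)).
Local Notation be := (fine (mu B)).

Let tA : tau_additive nA. Proof. exact: radon_restr_tau. Qed.
Let tB : tau_additive nB. Proof. exact: radon_restr_tau. Qed.
Let tC : tau_additive nC. Proof. exact: radon_restr_tau. Qed.

Let divm : continuous (fun p : G * G => (p.1^-1 * p.2)%g).
Proof.
apply: mulg_comp_continuous; last exact: continuous_snd.
by apply: invg_comp_continuous; exact: continuous_fst.
Qed.

(** This is the convolution of the two indicators ([convolution_corr]), written as the volume of an
    open section so that it is visibly lower semicontinuous. *)
Definition corr (x : G) : R := vol nA [set y | B (y^-1 * x)%g].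

Let oCB : open [set p : G * G | B (p.1^-1 * p.2)%g].
Proof. exact: open_preimage. Qed.

Lemma corr_blsc : blsc corr.
Proof. exact: (@vol_section2_blsc _ _ _ nA [set p : G * G | B (p.1^-1 * p.2)%g]). Qed.

Lemma corr_out x : ~ C x -> corr x = 0.
Proof.
move=> Cx; rewrite /corr -[LHS]/(fine (mu ([set y | B (y^-1 * x)%g] `&` A))).
rewrite (_ : _ `&` _ = set0) ?measure0//.
apply/seteqP; split=> y //= [By Ay]; apply: Cx; exists y => //.
by exists (y^-1 * x)%g => //; rewrite mulVKg.
Qed.

Let oleft (V : set G) (a : G) : open V -> open [set x | V (a * x)%g].
Proof.
by apply: open_preimage; apply: mulg_comp_continuous; [exact: cst_continuous|exact: id_continuous].
Qed.

Let oright (V : set G) (a : G) : open V -> open [set x | V (x * a)%g].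
Proof.
by apply: open_preimage; apply: mulg_comp_continuous; [exact: id_continuous|exact: cst_continuous].
Qed.

Let oinv (V : set G) : open V -> open [set x | V (x^-1)%g].
Proof. by apply: open_preimage; apply: invg_comp_continuous; exact: id_continuous. Qed.

Let left_vol (V : set G) (a : G) : open V -> mu [set x | V (a * x)%g] = mu V.
Proof. by move=> oV; apply: measure_left => //; exact: open_measurable_borel. Qed.

Let right_vol (V : set G) (a : G) : open V -> mu [set x | V (x * a)%g] = mu V.
Proof. by move=> oV; apply: measure_right => //; exact: open_measurable_borel. Qed.

Let inv_vol (V : set G) : open V -> mu [set x | V (x^-1)%g] = mu V.
Proof. by move=> oV; apply: measure_inv => //; exact: open_measurable_borel. Qed.

Lemma corr_le1 x : corr x <= al.
Proof.
rewrite -[leLHS]/(fine (mu ([set y | B (y^-1 * x)%g] `&` A))).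
apply: fine_measure_le => //; apply: openI => //.
exact: (oinv (oright x oB)).
Qed.

Lemma corr_le2 x : corr x <= be.
Proof.
have o := oinv (oright x oB).
have e : mu [set y | B (y^-1 * x)%g] = mu B.
  by rewrite (inv_vol (oright x oB)) right_vol.
by rewrite -e; apply: vol_restr_le => //; rewrite e.
Qed.

Lemma convolution_corr x : convolution mu \1_A \1_B x = (corr x)%:E.
Proof.
have o := oinv (oright x oB).
have oI : open ([set y | B (y^-1 * x)%g] `&` A) by exact: openI.
rewrite /corr volE; last exact: open_measurable_borel.
rewrite /convolution -[RHS]/(mu ([set y | B (y^-1 * x)%g] `&` A)).
transitivity (\int[mu]_y (\1_([set y | B (y^-1 * x)%g] `&` A) y : R)%:E)%E.
  apply: eq_integral => y _; congr (_%:E); rewrite !indicE in_setI mulrC -natrM mulnb.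
  by congr ((nat_of_bool (_ && _))%:R).
by rewrite integral_indic ?setIT//; exact: open_measurable_borel.
Qed.

(** [corr] vanishes off [C], and on [C] the measure [mu] agrees with its restriction. *)
Lemma mul_energy_corr : mul_energy mu A B = (\int[nC]_x (corr x ^+ 2))%:E.
Proof.
have bc := blsc_bmeas corr_blsc.
have int := bmeas_integrable nC (bmeasM bc bc).
rewrite /Rintegral fineK; last exact: integrable_fin_num int.
rewrite /mul_energy.
transitivity (\int[mu]_(x in C) (corr x ^+ 2)%:E)%E.
  rewrite [RHS]integral_mkcond; apply: eq_integral => x _.
  rewrite convolution_corr patchE; case: ifPn => [_|/negP Cx]; first by rewrite -EFin_expe.
  rewrite corr_out ?expe2 ?mule0//.
  by move=> h; apply: Cx; exact/mem_set.
transitivity (\int[nC]_(x in C) (corr x ^+ 2)%:E)%E.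
  apply: eq_measure_integral.
  by move=> V _ VC; rewrite -[RHS]/(mu (V `&` C)) setIidl.
rewrite [LHS]integral_mkcond; apply: eq_integral => x _.
rewrite patchE; case: ifPn => [//|/negP Cx].
by rewrite corr_out ?expr0n// => h; apply: Cx; exact/mem_set.
Qed.

(** Let [F c] be the volume of the pairs [(z, x)] in [P * P] with [z c^-1 x] in [P]. Its integral is
    at most the cube of the measure of [P], and [F c >= t * u] whenever [c] is in the product
    set. *)
Lemma popular_product_bound (P A3 B3 : set G) (t u : R) :
  open P -> P `<=` C -> open B3 -> A3 `<=` A -> B3 `<=` B -> 0 <= t ->
  (forall a b, A3 a -> B3 b -> u <= vol nA [set a' | P (a' * b)%g /\
     t < codeg nB [set p : G * G | P (p.1 * p.2)%g] a a']) ->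
  t * u * fine (mu (product_set A3 B3)) <= fine (mu P) ^+ 3.
Proof.
move=> oP PC oB3 A3A B3B t0 H.
set Gam := [set p : G * G | P (p.1 * p.2)%g] in H.
have oGam : open Gam by apply: open_preimage oP; exact: mulg_continuous.
have fP : (mu P < +oo)%E.
  apply: le_lt_trans fC; apply: le_measure; rewrite ?inE//; exact: open_measurable_borel.
have volP : vol nC P = fine (mu P) by exact: vol_restr_sub.
set pi := fine (mu P) in volP *.
have pi0 : 0 <= pi by exact/fine_ge0/measure_ge0.
have mG (V : set G) : open V -> measurable (V : set (borelType G)).
  exact: open_measurable_borel.
set D := product_set A3 B3.
have oD : open D by exact: open_product_set.
have DC : D `<=` C.
  by move=> x [a /A3A Aa [b /B3B Bb <-]]; exists a => //; exists b.
have c1 : continuous (fun q : G * G * G => q.1.1).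
  by move=> q; apply: (@continuous_comp _ _ _ fst fst); exact: continuous_fst.
have c2 : continuous (fun q : G * G * G => q.1.2).
  by move=> q; apply: (@continuous_comp _ _ _ fst snd); [exact: continuous_fst|exact: continuous_snd].
(* Triples [(c, z, x)]: [c] is represented as [x (z c^-1 x)^-1 z]. *)
pose W := [set q : G * G * G | (P q.1.2 /\ P q.2) /\ P (q.1.2 * q.1.1^-1 * q.2)%g].
have oW : open W.
  apply: openI; first apply: openI.
  - exact: open_preimage c2 oP.
  - exact: (open_preimage (@continuous_snd _ _) oP).
  - apply: open_preimage oP; apply: mulg_comp_continuous; last exact: continuous_snd.
    by apply: mulg_comp_continuous => //; exact: invg_comp_continuous.
pose F c := \int[nC]_z vol nC [set x | W (c, z, x)].
have bF : bmeas F.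
  apply: blsc_bmeas.
  exact: (@int_section_blsc _ _ _ nC (fun p => vol nC [set x | W (p, x)]) tC (vol_section1_blsc tC oW)).
have upper : \int[nC]_c F c <= pi ^+ 3.
  have iP : bmeas (\1_P : G -> R) by apply: bmeas_indic; exact: mG.
  have bW := vol_section_first_blsc tC oW.
  (* Now [c] is innermost. For fixed [z] and [x] in [P], the map sending [c] to [z c^-1 x] preserves
     [mu], so the admissible [c] have measure at most that of [P]. *)
  rewrite /F vol_section_rotate//.
  apply: (@le_trans _ _ (\int[nC]_z (pi * pi * \1_P z))); last first.
    by rewrite intZ// (int_indic nC (mG _ oP)) volP exprS expr2 mulrA.
  apply: le_int; [by apply: blsc_bmeas; exact: (int_section_blsc tC bW)|exact: bmeasZ|].
  move=> z; apply: (@le_trans _ _ (\int[nC]_x (pi * \1_P z * \1_P x))); last first.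
    by rewrite intZ// (int_indic nC (mG _ oP)) volP mulrAC.
  apply: le_int; [by apply: blsc_bmeas; exact: (blsc_section1 z bW)|exact: bmeasZ|].
  move=> x; rewrite !indicE.
  case: (boolP (z \in P)) => [/set_mem Pz|/negP Pz]; last first.
    rewrite mulr0 mul0r (_ : [set c | _] = set0) ?/vol ?measure0//.
    by apply/seteqP; split=> c //= [[/= h _] _]; apply: Pz; exact/mem_set.
  case: (boolP (x \in P)) => [/set_mem Px|/negP Px]; last first.
    rewrite mulr0 (_ : [set c | _] = set0) ?/vol ?measure0//.
    by apply/seteqP; split=> c //= [[_ /= h] _]; apply: Px; exact/mem_set.
  have o1 := oright x oP; have o2 := oleft z o1; have o3 := oinv o2.
  have e3 : mu [set c | P (z * c^-1 * x)%g] = mu P.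
    by rewrite (inv_vol o2) (left_vol z o1) right_vol.
  rewrite !mulr1 /pi -e3.
  rewrite (_ : [set c | W _] = [set c | P (z * c^-1 * x)%g]); last first.
    by apply/seteqP; split=> c /=; [case|split].
  by apply: vol_restr_le => //; rewrite e3.
apply: le_trans upper.
have iD : bmeas (\1_D : G -> R) by apply: bmeas_indic; exact: mG.
rewrite -(vol_restr_sub (open_measurable_borel oC) fC DC) -(int_indic nC (mG _ oD)) -intZ//.
apply: le_int => //; first exact: bmeasZ.
move=> c; rewrite indicE; case: (boolP (c \in D)) => [/set_mem Dc|_]; last first.
  rewrite mulr0; apply: Rintegral_ge0 => z _; exact: vol_ge0.
rewrite mulr1; case: Dc => a Aa [b Bb cE].
(* [S] holds the middle vertices [a'] of the paths from [a] to [b], and [Z] is its right translate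
   by [b], with [z = a' b]. *)
pose S := [set a' | P (a' * b)%g /\ t < codeg nB Gam a a'].
pose Z := [set z | P z /\ t < codeg nB Gam a (z * b^-1)%g].
have ocod : open [set a' | t < codeg nB Gam a a'].
  exact: (@open_section1 _ _ _ a (@open_codeg _ _ _ nB tB Gam t oGam)).
have oZ : open Z by apply: openI => //; exact: (oright b^-1%g ocod).
have oS : open S by apply: openI => //; exact: (oright b oP).
have ZC : Z `<=` C by move=> z [/PC].
have SZ : mu S = mu Z.
  rewrite -(right_vol b oZ); congr (mu _).
  by apply/seteqP; split=> z /=; rewrite /Z /= mulgK.
have fS : (mu S < +oo)%E.
  rewrite SZ; apply: le_lt_trans fC; apply: le_measure; rewrite ?inE//; exact: open_measurable_borel.
have uZ : u <= vol nC Z.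
  rewrite (vol_restr_sub (open_measurable_borel oC) fC ZC) -SZ.
  by apply: le_trans (H a b Aa Bb) _; exact: vol_restr_le.
have iZ : bmeas (\1_Z : G -> R) by apply: bmeas_indic; exact: mG.
apply: (@le_trans _ _ (t * vol nC Z)); first exact: ler_wpM2l.
rewrite -(int_indic nC (mG _ oZ)) -intZ//; apply: le_int; [exact: bmeasZ| |].
  by apply: blsc_bmeas; exact: (blsc_section1 c (vol_section1_blsc tC oW)).
move=> z; rewrite indicE; case: (boolP (z \in Z)) => [/set_mem [Pz tz]|_]; last first.
  by rewrite mulr0; exact: vol_ge0.
rewrite mulr1; apply: le_trans (ltW tz) _.
pose V := [set x | W (c, z, x)].
have oV : open V by exact: open_section1.
have VC : V `<=` C by move=> x [[_ /PC]].
have fV : (mu V < +oo)%E.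
  apply: le_lt_trans fC; apply: le_measure; rewrite ?inE//; exact: open_measurable_borel.
rewrite -/V (vol_restr_sub (open_measurable_borel oC) fC VC) -(left_vol a oV).
rewrite /codeg (_ : [set y | _] = [set y | V (a * y)%g]).
  by apply: vol_restr_le => //; [exact: oleft|rewrite left_vol].
(* With [z = a' b] and [c = a b], this is [z c^-1 (a y) = a' y]. *)
have E y : (z * c^-1 * (a * y) = z * b^-1 * y)%g.
  by rewrite -cE invgM -!mulgA mulKg.
apply/seteqP; split=> y; rewrite /V /W /Gam /= E; first by move=> [].
by move=> [[_ ?] ?].
Qed.

Lemma energy_product_bound (K s : R) : 0 < K -> 0 < s -> s ^+ 2 = al * be ->
  ((s ^+ 3 / K)%:E <= mul_energy mu A B)%E ->
  exists A3 B3, [/\ open A3 /\ A3 `<=` A, open B3 /\ B3 `<=` B,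
    al / (8 * K) <= fine (mu A3), be / (8 * K) <= fine (mu B3) &
    fine (mu (product_set A3 B3)) <= 256 * 24 * 8 * 16 * K ^+ 7 * s].
Proof.
move=> K0 s0 sE; rewrite mul_energy_corr lee_fin => hE.
have al0 : 0 < al.
  by apply: fine_gt0; rewrite fA andbT; apply: mulgroup_pos Hmu _ _ _ => //; case: mA.
have be0 : 0 < be.
  by apply: fine_gt0; rewrite fB andbT; apply: mulgroup_pos Hmu _ _ _ => //; case: mB.
have mG (V : set G) : open V -> measurable (V : set (borelType G)).
  exact: open_measurable_borel.
have volA : vol nA setT = al by rewrite -[LHS]/(fine (mu (setT `&` A))) setTI.
have volB : vol nB setT = be by rewrite -[LHS]/(fine (mu (setT `&` B))) setTI.
have bc := blsc_bmeas corr_blsc.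
have corr0 x : 0 <= corr x := vol_ge0 _ _.
(* [corr] is bounded by both [al] and [be], hence by their geometric mean. *)
have corrs x : corr x <= s.
  rewrite -(@ler_pXn2r _ 2)// ?nnegrE ?(ltW s0)// sE expr2.
  by apply: ler_pM => //; [exact: corr_le1|exact: corr_le2].
pose k := s / (2 * K).
have k0 : 0 < k by rewrite divr_gt0// mulr_gt0.
have kK : k * (2 * K) = s by rewrite /k divfK// mulf_neq0// gt_eqF.
pose P := [set x | k < corr x].
have oP : open P by case: corr_blsc => l _ _; exact: l.
have PC : P `<=` C.
  move=> x; rewrite /P /= => kx; apply: contrapT => /corr_out c0.
  by move: kx; rewrite c0; lra.
have volP : vol nC P = fine (mu P) by exact: vol_restr_sub.
set pi := fine (mu P) in volP *.
have iP : bmeas (\1_P : G -> R) by apply: bmeas_indic; exact: mG.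
have bcP : bmeas (fun x => corr x * \1_P x) by exact: bmeasM.
pose m : R := \int[nC]_x (corr x * \1_P x).
have int_corr : \int[nC]_x corr x <= s ^+ 2.
  rewrite -(@vol_section_swap _ _ _ nA nC [set p : G * G | B (p.1^-1 * p.2)%g])//.
  rewrite sE mulrC -volA -int_cst; apply: le_int.
  - by apply: blsc_bmeas; exact: vol_section1_blsc.
  - exact: bmeas_cst.
  - move=> a; have e := left_vol a^-1%g oB; rewrite -e.
    by apply: vol_restr_le => //; [exact: (oleft a^-1%g oB)|rewrite e].
have m_le : m <= s ^+ 2.
  apply: le_trans int_corr; apply: le_int => // x.
  by rewrite indicE; case: (_ \in _); rewrite ?mulr1 ?mulr0.
(* On [P], [corr^2 <= s * corr]; off [P], [corr^2 <= k * corr], which contributes at most [k * s^2],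
   half of the assumed energy. The threshold [k] is chosen for this. *)
have m_ge : s ^+ 2 / (2 * K) <= m.
  have : \int[nC]_x (corr x ^+ 2) <= \int[nC]_x (s * (corr x * \1_P x) + k * corr x).
    apply: le_int; [exact: bmeasM|by apply: bmeasD; exact: bmeasZ|].
    move=> x; rewrite indicE; case: (boolP (x \in P)) => [_|/negP Px] /=.
      rewrite mulr1 expr2; apply: (@le_trans _ _ (s * corr x)); first exact: ler_wpM2r.
      by rewrite lerDl mulr_ge0// ltW.
    rewrite !mulr0 add0r expr2; apply: ler_wpM2r => //.
    by rewrite leNgt; apply/negP => h; apply: Px; exact/mem_set.
  rewrite (intD nC (bmeasZ s bcP) (bmeasZ k bc)) !intZ// -/m => /(le_trans hE) h1.
  have h2 := ler_wpM2l (ltW k0) int_corr.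
  have h3 : s ^+ 3 / K <= s * m + k * s ^+ 2 by lra.
  have e1 : s ^+ 3 / K = 2 * (s * (s ^+ 2 / (2 * K))) by field; rewrite gt_eqF.
  have e2 : k * s ^+ 2 = s * (s ^+ 2 / (2 * K)) by rewrite /k; field; rewrite gt_eqF.
  rewrite e1 e2 in h3; rewrite -(@ler_pM2l _ s)//.
  by move: (s * _) h3 => q; lra.
have pi_le : k * pi <= m.
  rewrite -volP -(int_indic nC (mG _ oP)) -intZ//; apply: le_int => //; first exact: bmeasZ.
  move=> x; rewrite indicE; case: (boolP (x \in P)) => [/set_mem Px|_] /=.
    by rewrite !mulr1 ltW.
  by rewrite !mulr0.
(* The exact edge density of the graph, kept instead of its lower bound [1 / (2 K)] because the
   bound on [pi] is proportional to it. *)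
pose dl := m / s ^+ 2.
have s20 : 0 < s ^+ 2 by exact: exprn_gt0.
have mE : m = dl * s ^+ 2 by rewrite /dl divfK// gt_eqF.
have dl1 : dl <= 1 by rewrite /dl ler_pdivrMr// mul1r.
have dlK : 1 <= 2 * K * dl.
  have : s ^+ 2 / (2 * K) * (2 * K) <= m * (2 * K) by rewrite ler_wpM2r// mulr_ge0// ltW.
  rewrite divfK ?mulf_neq0 ?gt_eqF// mE => h.
  by rewrite -(@ler_pM2r _ (s ^+ 2))//; lra.
have dl0 : 0 < dl.
  have K2 : 0 < 2 * K by rewrite mulr_gt0.
  by rewrite -(pmulr_rgt0 _ K2); apply: lt_le_trans dlK.
have pi_s : pi <= 2 * K * dl * s.
  rewrite -(@ler_pM2l _ k)//; apply: le_trans pi_le _; rewrite mE.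
  have e : k * (2 * K * dl * s) = k * (2 * K) * dl * s by ring.
  by rewrite e kK; lra.
have oGam : open [set p : G * G | P (p.1 * p.2)%g].
  by apply: open_preimage oP; exact: mulg_continuous.
pose W := [set p : G * G | P p.2 /\ B (p.1^-1 * p.2)%g].
have oW : open W.
  by apply: openI => //; exact: (open_preimage (@continuous_snd _ _) oP).
(* Left translation replaces [b] by [x = a b]; after the exchange, each [x] in [P] contributes
   [corr x]. *)
have dens : \int[nA]_a vol nB [set b | P (a * b)%g] = m.
  transitivity (\int[nA]_a vol nC [set x | W (a, x)]).
    apply: eq_Rintegral => a _.
    have oWa : open [set x | W (a, x)] by exact: open_section1.
    rewrite [RHS]vol_restr_sub; last by move=> x [/PC].
    rewrite -(left_vol a oWa) -[LHS]/(fine (mu ([set b | P (a * b)%g] `&` B))).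
    by congr (fine (mu _)); apply/seteqP; split=> b; rewrite /W /= mulKg.
  rewrite vol_section_swap//; apply: eq_Rintegral => x _; rewrite indicE.
  case: (boolP (x \in P)) => [/set_mem Px|/negP Px] /=.
    rewrite mulr1 /corr; congr (vol nA _).
    by apply/seteqP; split=> y; [case|split].
  rewrite mulr0 (_ : [set a | _] = set0) ?/vol ?measure0//.
  by apply/seteqP; split=> y //= [h _]; apply: Px; exact/mem_set.
have [|||A' [B' [oA' oB' hA hB paths]]] := @dense_graph_paths _ _ _ nA nB tA tB _ dl oGam dl0.
- by rewrite volA.
- by rewrite volB.
- by rewrite volA volB dens mE sE mulrA.
rewrite volA volB in hA hB paths.
have fin8 (x : R) : 0 < x -> x / (8 * K) <= dl * x / 4.
  move=> x0; rewrite ler_pdivrMr ?mulr_gt0//.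
  by have := ler_wpM2l (ltW x0) dlK; lra.
(* [A'] and [B'] are open in [G] and need not lie in [A] and [B]; the restricted measures see only
   these intersections. *)
have oA3 : open (A' `&` A) by exact: openI.
have oB3 : open (B' `&` B) by exact: openI.
have path3 a b : (A' `&` A) a -> (B' `&` B) b -> dl ^+ 2 * al / 24 <=
    vol nA [set a' | P (a' * b)%g /\ dl ^+ 3 * be / 256 <
      codeg nB [set p : G * G | P (p.1 * p.2)%g] a a'].
  by move=> [A'a _] [B'b _]; exact: paths.
have t0 : 0 <= dl ^+ 3 * be / 256.
  by apply: divr_ge0; [apply: mulr_ge0; [apply: exprn_ge0; exact: ltW|exact: ltW]|exact: ler0n].
have D := @popular_product_bound P (A' `&` A) (B' `&` B) _ _ oP PC oB3
  (@subIsetr _ _ _) (@subIsetr _ _ _) t0 path3.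
exists (A' `&` A), (B' `&` B); split => //.
- by apply: le_trans (fin8 _ al0) _; exact: hA.
- by apply: le_trans (fin8 _ be0) _; exact: hB.
move: D; set v := fine (mu (product_set _ _)); rewrite -/pi => D.
have v0 : 0 <= v by exact/fine_ge0/measure_ge0.
have pi0 : 0 <= pi by exact/fine_ge0/measure_ge0.
have pi3 : pi ^+ 3 <= (2 * K * dl * s) ^+ 3 by rewrite ler_pXn2r// nnegrE// (le_trans pi0).
have h1 : dl ^+ 5 * s ^+ 2 * v <= 256 * 24 * (2 * K * dl * s) ^+ 3.
  have e : dl ^+ 5 * s ^+ 2 * v =
      256 * 24 * (dl ^+ 3 * be / 256 * (dl ^+ 2 * al / 24) * v).
    by rewrite sE; field.
  by rewrite e; apply: ler_wpM2l; [rewrite -natrM ler0n|exact: le_trans D pi3].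
(* The factors 256 and 24 come from the path count, and 8 from the cube of [2 * K]. Cancelling
   [dl^3 s^2] in [h1] leaves this bound on [dl^2 * v]. *)
pose q := 256 * 24 * 8 * K ^+ 3 * s.
have q0 : 0 <= q.
  apply: mulr_ge0 (ltW s0); apply: mulr_ge0; last exact/exprn_ge0/ltW.
  by rewrite -!natrM ler0n.
have h2 : dl ^+ 2 * v <= q.
  have ds : 0 < dl ^+ 3 * s ^+ 2 by apply: mulr_gt0 => //; exact: exprn_gt0.
  rewrite -(ler_pM2l ds).
  have e1 : dl ^+ 3 * s ^+ 2 * (dl ^+ 2 * v) = dl ^+ 5 * s ^+ 2 * v by ring.
  have e2 : dl ^+ 3 * s ^+ 2 * q = 256 * 24 * (2 * K * dl * s) ^+ 3 by rewrite /q; ring.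
  by rewrite e1 e2.
have -> : 256 * 24 * 8 * 16 * K ^+ 7 * s = (2 * K) ^+ 2 * ((2 * K) ^+ 2 * q).
  by rewrite /q; ring.
clearbody q.
have h3 : v <= (2 * K) ^+ 2 * (dl ^+ 2 * v).
  by rewrite mulrA -exprMn -[leLHS]mul1r ler_wpM2r// exprn_ege1.
have K1 : 1 <= 2 * K by apply: le_trans dlK _; rewrite ler_piMr// mulr_ge0// ltW.
have K2 : 0 <= (2 * K) ^+ 2 by exact: sqr_ge0.
have h4 : v <= (2 * K) ^+ 2 * q by apply: le_trans h3 _; exact: ler_wpM2l.
(* At this point [v] is bounded by a multiple of [K^5 * s]; since [2 * K >= 1], one more factor
   [(2 * K)^2] gives the power [K^7]. *)
apply: le_trans h4 _; apply: ler_wpM2l => //.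
by rewrite -[leLHS]mul1r ler_wpM2r// exprn_ege1.
Qed.

End energy.

(** * Passage between extended and real measures *)

Theorem theorem5p2 (R : realType) :
  exists C : R,
  forall (G : topologicalGroupType)
         (mu : {measure set (borelType G) -> \bar R})
         (A B : set G) (K : R),
    multiplicative_group mu ->
    multiplicative_set A -> multiplicative_set B ->
    0 < K ->
    (mu A `^ (3 / 2) * mu B `^ (3 / 2) / K%:E <= mul_energy mu A B)%E ->
    exists A3 B3 : set G,
      [/\ multiplicative_set A3 /\ A3 `<=` A,
          multiplicative_set B3 /\ B3 `<=` B,
          (mu A / (8 * Num.sqrt 2 * K)%:E <= mu A3)%E,
          (mu B / (8 * K)%:E <= mu B3)%E &
          (mu (product_set A3 B3)
             <= (C * K ^+ 7)%:E * mu A `^ (1 / 2) * mu B `^ (1 / 2))%E].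
Proof.
exists (256 * 24 * 8 * 16) => G mu A B K Hmu mA mB K0.
have [A0 oA pA] := mA; have [B0 oB pB] := mB.
have fA := precompact_finite Hmu oA pA.
have fB := precompact_finite Hmu oB pB.
have fC := product_set_finite Hmu mA mB.
have oC : open (product_set A B) by exact: open_product_set.
have finE U V : open U -> open V -> (mu V < +oo)%E -> U `<=` V -> (fine (mu U))%:E = mu U.
  move=> oU oV fV UV; apply: fineK; rewrite ge0_fin_numE//.
  apply: le_lt_trans fV; apply: le_measure; rewrite ?inE//; exact: open_measurable_borel.
have gt0 U : open U -> U !=set0 -> (mu U < +oo)%E -> 0 < fine (mu U).
  by move=> oU U0 fU; apply: fine_gt0; rewrite fU andbT; exact: mulgroup_pos Hmu _ oU U0.
have al0 := gt0 _ oA A0 fA; have be0 := gt0 _ oB B0 fB.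
rewrite -(finE A A)// -(finE B B)//.
move: al0 be0 (@energy_product_bound _ _ _ Hmu _ _ mA mB K).
move: (fine (mu A)) (fine (mu B)) => al be al0 be0 main.
have invE (c : R) : 0 < c -> (c%:E^-1)%E = (c^-1)%:E.
  by move=> c0; rewrite inver gt_eqF.
have K8 : 0 < 8 * K by rewrite mulr_gt0.
have K8s : 0 < 8 * Num.sqrt 2 * K by rewrite !mulr_gt0// sqrtr_gt0.
rewrite !poweR_EFin (invE _ K0) (invE _ K8) (invE _ K8s) -!EFinM.
have half3 (x : R) : 0 < x -> x `^ (3 / 2) = (x `^ (1 / 2)) ^+ 3.
  by move=> x0; rewrite -powR_mulrn ?powR_ge0// -powRrM; congr (_ `^ _); field.
have half2 (x : R) : 0 < x -> (x `^ (1 / 2)) ^+ 2 = x.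
  move=> x0; rewrite -powR_mulrn ?powR_ge0// -powRrM.
  by rewrite (_ : 1 / 2 * 2 = 1) ?powRr1 ?ltW//; field.
rewrite !half3// -exprMn => hE.
(* The geometric mean of the two measures; the energy hypothesis now reads [s^3 / K]. *)
set s := al `^ (1 / 2) * be `^ (1 / 2) in hE.
have s0 : 0 < s by rewrite mulr_gt0// powR_gt0.
have sE : s ^+ 2 = al * be by rewrite exprMn !half2.
have [A3 [B3 [[oA3 A3A] [oB3 B3B] hA hB hAB]]] := main s K0 s0 sE hE.
(* Multiplicative sets are nonempty by definition; here this follows from the positive lower bounds
   on the measures. *)
have nonempty U (x : R) : 0 < x -> x / (8 * K) <= fine (mu U) -> U !=set0.
  move=> x0 h; apply/set0P/eqP => U0; move: h; rewrite U0 measure0 /=.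
  by rewrite leNgt divr_gt0// mulr_gt0.
exists A3, B3; split.
- split=> //; split=> //; last exact: precompact_subset pA.
  exact: nonempty al0 hA.
- split=> //; split=> //; last exact: precompact_subset pB.
  exact: nonempty be0 hB.
(* The bound [al / (8 * K)] is weakened by the factor [sqrt 2 >= 1]. *)
- rewrite -(finE A3 A)// lee_fin; apply: le_trans hA.
  rewrite ler_pM2l// lef_pV2 ?posrE ?mulr_gt0 ?sqrtr_gt0//.
  rewrite ler_pM2r// ler_peMr// -[leLHS]sqrtr1 ler_wsqrtr//.
  by rewrite ler1n.
- by rewrite -(finE B3 B)// lee_fin.
- rewrite -(finE (product_set A3 B3) (product_set A B))//.
  + by rewrite lee_fin -mulrA.
  + exact: open_product_set.
  + by move=> x [a /A3A Aa [b /B3B Bb <-]]; exists a => //; exists b.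
Qed.
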